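(* Let $L\cong\prec a_1,\ldots,a_n\succ$ be a lattice over the dyadic local field $F$, relative to a good BONG, and let $L=L_1\perp\cdots\perp L_t$ be a Jordan decomposition. Let $1\le k\le t$ and $n_{k-1}\le i<n_k$. (i) If $i\equiv n_{k-1}\pmod 2$ then $X_i=(-1)^{(i-n_{k-1})/2}\det FL_{(k-1)}$ approximates $a_{1,i}$. (ii) If $i\equiv n_{k-1}+1\pmod 2$ then $X_i=\mathsf a_k\det FL_{(k-1)}$ approximates $a_{1,i}$.
   Context: $F$ is a dyadic local field (a finite extension of $\mathbb Q_2$) with ring of integers $\mathcal O$, maximal ideal $\mathfrak p$, normalized valuation $\operatorname{ord}$, and $e=\operatorname{ord}2$. For $a\in F^\times$ the quadratic defect $\mathfrak d(a)$ is the intersection of all ideals $b\mathcal O$ with $b\in F$ such that $a=c^2+b$ for some $c\in F$; $d(a):=\operatorname{ord}(a^{-1}\mathfrak d(a))\in\{0,1,3,\ldots,2e-1,2e,\infty\}$, depending only on the class of $a$ in $F^\times/(F^\times)^2$. Quadratic spaces are finite dimensional nondegenerate, with form $Q$ and bilinear form $B$, $Q(x)=B(x,x)$. A lattice $L$ is a finitely generated $\mathcal O$-submodule of a quadratic space with $FL$ nondegenerate. $\mathfrak sL$ (scale) is the ideal generated by $B(L,L)$, $\mathfrak nL$ (norm) is the ideal generated by $Q(L)$, $\mathfrak gL=Q(L)+2\mathfrak sL$ is the norm group, and a norm generator $a$ of the norm group $\mathfrak gL$ (also called a norm generator for $L$) is an element $a\in\mathfrak gL$ with $a\mathcal O=\mathfrak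 nL$. For an ideal $\mathfrak a$, $L^{\mathfrak a}=\{x\in L\mid B(x,L)\subseteq\mathfrak a\}$. BONGs: a vector $x\in L$ is a norm generator of $L$ if $\mathfrak nL=Q(x)\mathcal O$. A sequence $x_1,\ldots,x_n$ is a BONG of $L$ if $x_1$ is a norm generator of $L$ and $x_2,\ldots,x_n$ is a BONG of the orthogonal projection $pr_{x_1^\perp}L$. A BONG determines $L$ uniquely; write $L\cong\prec a_1,\ldots,a_n\succ$ when $Q(x_i)=a_i$. The BONG is good if $\operatorname{ord}a_i\le\operatorname{ord}a_{i+2}$ for $1\le i\le n-2$. For a good BONG put $R_i=\operatorname{ord}a_i$ and, for $1\le i\le n-1$, let $\alpha_i=\alpha_i(L)$ be the minimum of $$\{\tfrac{R_{i+1}-R_i}2+e\}\cup\{R_{i+1}-R_j+d(-a_ja_{j+1})\mid 1\le j\le i\}\cup\{R_{j+1}-R_i+d(-a_ja_{j+1})\mid i\le j\le n-1\}.$$ $R_i$ and $\alpha_i$ do not depend on the good BONG. $a_{1,i}=a_1\cdots a_i$, $a_{1,0}=1$. Jordan decomposition: $L_1,\ldots,L_t$ are modular with $\mathfrak sL_1\supset\cdots\supset\mathfrak sL_t$ (strict). $L_{(k)}=L_1\perp\cdots\perp L_k$, $n_k=\dim L_{(k)}$, with $L_{(0)}=0$, $n_0=0$, $\det FL_{(0)}=1$; $\mathsf a_k$ is any norm generator for $L^{\mathfrak sL_k}$. $X_i\in F^\times/(F^\times)^2$ approximates $a_{1,i}$ means: $d(a_{1,i}X_i)\ge\alpha_i$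 if $1\le i\le n-1$; $X_i=a_{1,i}$ in $F^\times/(F^\times)^2$ if $i\in\{0,n\}$. *)

(* Defs.v *)
From HB Require Import structures.
From mathcomp Require Import all_boot all_order all_algebra.
From mathcomp Require Import boolp classical_sets constructive_ereal.

Set Implicit Arguments.
Unset Strict Implicit.
Unset Printing Implicit Defensive.

Import Order.TTheory GRing.Theory Num.Theory.

Local Open Scope classical_set_scope.
Local Open Scope ring_scope.

(* [ord] is meaningful on nonzero elements only (its value at 0 is unspecified);
   [val] adds the convention ord 0 = +oo. *)
Definition val (F : fieldType) (ord : F -> int) (x : F) : \bar rat :=
  if x == 0 then +oo%E else ((ord x)%:~R)%:E.

(* O'Meara's definition: a field of characteristic 0, complete under a discrete
   valuation with finite residue field, in which 2 is not a unit; these are the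
   finite extensions of Q_2, and [ord] is their unique normalized valuation. *)
Record dyadic_local_field (F : fieldType) (ord : F -> int) : Prop := {
  dlf_char0 : [pchar F] =i pred0;
  dlf_ordM : forall x y : F, x != 0 -> y != 0 -> ord (x * y) = ord x + ord y;
  dlf_ordD : forall x y : F, x != 0 -> y != 0 -> x + y != 0 ->
    Num.min (ord x) (ord y) <= ord (x + y);
  dlf_ord_normalized : forall m : int, exists2 x : F, x != 0 & ord x = m;
  dlf_complete : forall u : nat -> F,
    (forall m : int, exists N : nat, forall p q : nat, (N <= p)%N -> (N <= q)%N ->
       ((m%:~R)%:E <= val ord (u p - u q))%E) ->
    exists l : F, forall m : int, exists N : nat, forall p : nat, (N <= p)%N ->
       ((m%:~R)%:E <= val ord (u p - l))%E;
  dlf_finite_residue_field : exists s : seq F, forall x : F, (0 <= val ord x)%E ->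
    exists2 y : F, y \in s & (0 <= val ord y)%E /\ (0 < val ord (x - y))%E;
  dlf_dyadic : 0 < ord 2%:R }.

Section FieldInvariants.
Context {F : fieldType} (ord : F -> int).

Definition O : set F := [set x | (0 <= val ord x)%E].

Definition Osubmodule (V : lmodType F) (M : set V) : Prop :=
  [/\ M 0, forall x y, M x -> M y -> M (x + y) &
      forall c x, O c -> M x -> M (c *: x)].

Definition Ospan (V : lmodType F) (S : set V) : set V :=
  smallest (@Osubmodule V) S.

(* Ideals are O-submodules of F regarded as a module over itself. *)
Definition ideal_gen (S : set F) : set F := @Ospan F^o S.

Definition principal (b : F) : set F := [set b * x | x in O].

(* ord of a (possibly zero) principal ideal: the ord of any generator. *)
Definition ord_ideal (I : set F) : \bar rat :=
  val ord (xget 0 [set b | I = principal b]).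

Definition quad_defect (a : F) : set F :=
  \bigcap_(b in [set b | exists c : F, a = c ^+ 2 + b]) principal b.

Definition d (a : F) : \bar rat :=
  ord_ideal [set a^-1 * x | x in quad_defect a].

(* Sequences a_1, ..., a_n are numbered from 1. *)
Definition ent (a : seq F) (j : nat) : F := a`_(j.-1).

Definition R (a : seq F) (j : nat) : rat := (ord (ent a j))%:~R.

Definition e : rat := (ord 2%:R)%:~R.

Definition dd (a : seq F) (j : nat) : \bar rat := d (- ent a j * ent a j.+1).

Definition alpha (a : seq F) (i : nat) : \bar rat :=
  mine ((R a i.+1 - R a i) / 2%:R + e)%:E
    (mine (\big[mine/+oo%E]_(1 <= j < i.+1) ((R a i.+1 - R a j)%:E + dd a j)%E)
          (\big[mine/+oo%E]_(i <= j < size a) ((R a j.+1 - R a i)%:E + dd a j)%E)).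

Definition prefix_prod (a : seq F) (i : nat) : F :=
  \prod_(1 <= j < i.+1) ent a j.

(* A class in F^x / (F^x)^2 is given by a nonzero representative X; the
   property does not depend on the choice of the representative. *)
Definition approximates (a : seq F) (i : nat) (X : F) : Prop :=
  [/\ X != 0,
      (1 <= i < size a)%N -> (alpha a i <= d (prefix_prod a i * X))%E &
      i = 0%N \/ i = size a ->
        exists2 c : F, c != 0 & X = prefix_prod a i * c ^+ 2].

End FieldInvariants.

Section Lattices.
Context {F : fieldType} (ord : F -> int) {V : vectType F} (B : {symmetric V}).

Definition Q (x : V) : F := B x x.

Definition Fset (L : set V) : set V := [set v | exists c x, L x /\ v = c *: x].

(* FL as a subspace; [Fset L] is a subspace whenever L is an O-submodule. *)
Definition Fspace (L : set V) : {vspace V} :=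
  xget 0%VS [set W : {vspace V} | [set x | x \in W] = Fset L].

Definition rank (L : set V) : nat := \dim (Fspace L).

Definition gram (b : seq V) : 'M[F]_(size b) := \matrix_(i, j) B b`_i b`_j.

(* A representative of the determinant of the quadratic space FL in
   F^x / (F^x)^2; it is 1 for L = 0. *)
Definition det_space (L : set V) : F := \det (gram (vbasis (Fspace L))).

Definition lattice (L : set V) : Prop :=
  (exists s : seq V, L = Ospan ord [set` s]) /\
  (forall x, Fset L x -> (forall y, Fset L y -> B x y = 0) -> x = 0).

Definition scale (L : set V) : set F :=
  ideal_gen ord [set c | exists x y, [/\ L x, L y & c = B x y]].

Definition norm (L : set V) : set F := ideal_gen ord (Q @` L).

Definition norm_group (L : set V) : set F :=
  [set c | exists x s, [/\ L x, scale L s & c = Q x + 2%:R * s]].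

Definition group_norm_generator (L : set V) (a : F) : Prop :=
  norm_group L a /\ principal ord a = norm L.

Definition part_in (L : set V) (I : set F) : set V :=
  [set x | L x /\ forall y, L y -> I (B x y)].

Definition proj_orth (x y : V) : V := y - (B x y / Q x) *: x.

(* The vectors of a BONG are anisotropic, as the projection requires; this
   only excludes the vector 0 in the lattice 0. *)
Fixpoint is_bong (xs : seq V) (L : set V) : Prop :=
  if xs is x :: xs' then
    [/\ L x, Q x != 0, norm L = principal ord (Q x)
      & is_bong xs' (proj_orth x @` L)]
  else L = [set 0].

Definition good (a : seq F) : Prop :=
  forall i, (1 <= i)%N -> (i.+2 <= size a)%N -> ord (ent a i) <= ord (ent a i.+2).

Definition has_good_bong (L : set V) (a : seq F) : Prop :=
  exists xs : seq V, [/\ is_bong xs L, a = [seq Q x | x <- xs] & good a].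

Definition volume (L : set V) : set F :=
  ideal_gen ord [set \det (gram b) | b in
    [set b : seq V | free b /\ L = Ospan ord [set` b]]].

(* L is nonzero, sL = cO and vL = (cO)^(rank L). *)
Definition modular (L : set V) : Prop :=
  [/\ lattice L, (0 < rank L)%N &
    exists c : F, [/\ c != 0, scale L = principal ord c &
      volume L = principal ord (c ^+ rank L)]].

(* L_(k) = L_1 + ... + L_k, the components being numbered from 1. *)
Definition partial_sum (Ls : nat -> set V) (k : nat) : set V :=
  [set v | exists x : nat -> V, (forall j, (1 <= j <= k)%N -> Ls j (x j)) /\
                                v = \sum_(1 <= j < k.+1) x j].

Definition jordan_decomposition (L : set V) (t : nat) (Ls : nat -> set V) : Prop :=
  [/\ forall j, (1 <= j <= t)%N -> modular (Ls j),
      forall j, (1 <= j < t)%N -> scale (Ls j.+1) `<` scale (Ls j),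
      forall j l x y, (1 <= j <= t)%N -> (1 <= l <= t)%N -> j <> l ->
        Ls j x -> Ls l y -> B x y = 0 &
      L = partial_sum Ls t].

End Lattices.

(* Main.v *)
(* By the definition of the R_i, a good BONG splits L into unary blocks (a_j), when
   R_j <= R_(j+1), and binary modular blocks carrying a_j, a_(j+1), when
   R_j > R_(j+1); the scales of the blocks are nondecreasing. Let r = ord of the
   scale of L_k and let P be the sum of the m blocks of scale order < r.

   1. If 2r >= R_i + R_(i+1), evaluating Q block by block shows that Q(L^(p^r)) lies
   in the group G of elements a_i X^2 + w with ord X >= max(0, (R_(i+1) - R_i)/2) and
   ord w >= R_i + alpha_i.

   2. Let z be a basis of L_(k-1). The splittings of L off L_(k-1) and off P have
   complements of scale in p^r, so comparing coordinates modulo p shows that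
   m = n_(k-1), and that the Gram matrix of z is congruent over O to Gamma + E,
   where Gamma is the Gram matrix of P and E is a matrix over p^r with diagonal
   in G (i = m). Such matrices E are stable under Schur complements with respect to
   the blocks of Gamma, whence d(det Gamma det(Gamma + E)) >= alpha_m; this is the
   case i = m of the theorem. The bound rests on the observation that
   u^2 + X^2 + w, with u a unit, is (u + X)^2 up to terms of order >= alpha_m.

   3. For n_(k-1) < i < n_k one has alpha_i <= alpha_m, the numbers
   d(-a_j a_(j+1)), j = m+1, m+3, ..., are >= alpha_i, and by 1 a norm generator of
   L^(p^r) agrees with a_i up to a square and defect >= alpha_i. *)

Require Import Defs.
From HB Require Import structures.
From mathcomp Require Import all_boot all_order all_algebra.
From mathcomp Require Import boolp classical_sets constructive_ereal.
From mathcomp Require Import perm sesquilinear.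
From mathcomp Require Import ring lra zify.

Set Implicit Arguments.
Unset Strict Implicit.
Unset Printing Implicit Defensive.

Import Order.TTheory GRing.Theory Num.Theory.

Local Open Scope classical_set_scope.
Local Open Scope ring_scope.

(* [lia] slows down badly in the presence of inequalities between rationals. *)
Ltac nlia :=
  repeat match goal with H : ?T |- _ =>
    lazymatch T with
    | nat => fail
    | is_true (leq _ _) => fail
    | is_true (andb (leq _ _) _) => fail
    | is_true (negb (@eq_op ?U _ _)) =>
        tryif unify (Equality.sort U) nat then fail else clear H
    | @eq ?U _ _ => tryif unify U nat then fail else clear H
    | or (@eq nat _ _) (@eq nat _ _) => fail
    | _ => clear H
    end
  end; lia.

(** * Valuation and quadratic defect *)

Section Valuation.
Context {F : fieldType} (ord : F -> int) (hF : dyadic_local_field ord).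

(** The obstacle is that the Jordan components and the blocks of the BONG belong to different
    splittings of L, and no component need match a block. What the splittings share is the rank of
    the part below a given scale. The cut for n_(k-1) is made at r, the cut for n_k at r + 1/2,
    which lies between the order of the scale of L_k and the next integer. Between the two cuts
    every sum R_l + R_(l+1) is squeezed to 2r, so the R_l alternate there. The group G need not be
    the norm group of L^(p^r); it only has to contain the values of Q there. Its shape, a_i times a
    square plus a remainder, reflects what has to be absorbed: cross terms carry a factor 2 and are
    paid for by the term (R_(i+1) - R_i)/2 + e of alpha_i, while exchanging some a_j for a_i is paid
    for by the terms with d(-a_l a_(l+1)). Each alpha_i is used only through its rational lower
    bounds al, and those with al <= 0 are trivial because d >= 0. *)

Definition ov (x : F) : rat := (ord x)%:~R.
(** The value of [ord] at 0 is unspecified; the guard lets 0 satisfy every bound. Thresholds are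
    rational because half-sums such as (R_i + R_(i+1))/2 occur. *)
Definition vge (q : rat) (x : F) : Prop := x != 0 -> q <= ov x.
Definition vgt (q : rat) (x : F) : Prop := x != 0 -> q < ov x.

Lemma two_neq0 : 2%:R != 0 :> F.
Proof. by have /pcharf0P -> := dlf_char0 hF. Qed.

Lemma ovM x y : x != 0 -> y != 0 -> ov (x * y) = ov x + ov y.
Proof. by move=> x0 y0; rewrite /ov (dlf_ordM hF) // rmorphD. Qed.

Lemma ov1 : ov 1 = 0.
Proof. by have := ovM (oner_neq0 F) (oner_neq0 F); rewrite mulr1; lra. Qed.

Lemma ovN1 : ov (-1) = 0.
Proof.
have n0 : (-1 : F) != 0 by rewrite oppr_eq0 oner_neq0.
have := ovM n0 n0; rewrite mulrNN mulr1 ov1; lra.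
Qed.

Lemma ovN x : ov (- x) = ov x.
Proof.
have [->|x0] := eqVneq x 0; first by rewrite oppr0.
by rewrite -mulN1r ovM ?oppr_eq0 ?oner_neq0 // ovN1 add0r.
Qed.

Lemma ovV x : x != 0 -> ov x^-1 = - ov x.
Proof.
move=> x0; have := ovM x0 (invr_neq0 x0); rewrite divff // ov1; lra.
Qed.

Lemma ovX2 x : x != 0 -> ov (x ^+ 2) = 2 * ov x.
Proof. by move=> x0; rewrite expr2 ovM //; lra. Qed.

Lemma ov2_gt0 : 0 < e ord.
Proof. by rewrite /e ltr0z (dlf_dyadic hF). Qed.

Lemma ov_int_lt x y : ov x < ov y -> ov x + 1 <= ov y.
Proof. by rewrite /ov ltr_int -[1]/(1%:~R) -intrD ler_int lezD1. Qed.

Lemma ov_surj (m : int) : exists2 x : F, x != 0 & ov x = m%:~R.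
Proof. by have [x x0 <-] := dlf_ord_normalized hF m; exists x. Qed.

Lemma vge0 q : vge q 0. Proof. by rewrite /vge eqxx. Qed.

Lemma vge_ov x : vge (ov x) x. Proof. by move=> _. Qed.

Lemma vgeW q q' x : vge q x -> q' <= q -> vge q' x.
Proof. by move=> h le x0; exact: le_trans le (h x0). Qed.

Lemma vge_vgt q q' x : vge q x -> q' < q -> vgt q' x.
Proof. by move=> h le x0; exact: lt_le_trans le (h x0). Qed.

Lemma vgt_vge q x : vgt q x -> vge q x.
Proof. by move=> h x0; exact: ltW (h x0). Qed.

Lemma vgeM q q' x y : vge q x -> vge q' y -> vge (q + q') (x * y).
Proof.
move=> hx hy; rewrite /vge mulf_eq0 negb_or => /andP[x0 y0].
by rewrite ovM // lerD ?hx ?hy.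
Qed.

Lemma vgtM q q' x y : vge q x -> vgt q' y -> vgt (q + q') (x * y).
Proof.
move=> hx hy; rewrite /vgt mulf_eq0 negb_or => /andP[x0 y0].
by rewrite ovM // ler_ltD ?hx ?hy.
Qed.

Lemma ov_min x y : x != 0 -> y != 0 -> x + y != 0 ->
  Num.min (ov x) (ov y) <= ov (x + y).
Proof.
move=> x0 y0 xy0; have := dlf_ordD hF x0 y0 xy0.
by rewrite !ge_min /ov !ler_int.
Qed.

Lemma vgeD q x y : vge q x -> vge q y -> vge q (x + y).
Proof.
have [->|x0] := eqVneq x 0; first by rewrite add0r.
have [->|y0] := eqVneq y 0; first by rewrite addr0.
move=> hx hy xy0; apply: le_trans (ov_min x0 y0 xy0).
by rewrite le_min hx ?hy.
Qed.

Lemma vgtD q x y : vgt q x -> vgt q y -> vgt q (x + y).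
Proof.
have [->|x0] := eqVneq x 0; first by rewrite add0r.
have [->|y0] := eqVneq y 0; first by rewrite addr0.
move=> hx hy xy0; apply: lt_le_trans (ov_min x0 y0 xy0).
by rewrite lt_min hx ?hy.
Qed.

Lemma vgeN q x : vge q x -> vge q (- x).
Proof. by rewrite /vge oppr_eq0 ovN. Qed.

Lemma vgeB q x y : vge q x -> vge q y -> vge q (x - y).
Proof. by move=> hx hy; apply: vgeD => //; apply: vgeN. Qed.

Lemma vge_sum q (I : Type) (r : seq I) (P : pred I) (f : I -> F) :
  (forall i, P i -> vge q (f i)) -> vge q (\sum_(i <- r | P i) f i).
Proof.
by move=> h; elim/big_ind: _ => //; [exact: vge0 | move=> x y; exact: vgeD].
Qed.

Lemma vgt_sum q (I : Type) (r : seq I) (P : pred I) (f : I -> F) :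
  (forall i, P i -> vgt q (f i)) -> vgt q (\sum_(i <- r | P i) f i).
Proof.
by move=> h; elim/big_ind: _ => //; [rewrite /vgt eqxx | move=> x y; exact: vgtD].
Qed.

Lemma vgeV x : vge (- ov x) x^-1.
Proof. by rewrite /vge invr_eq0 => x0; rewrite ovV. Qed.

Lemma vge_div q x y : vge q x -> vge (q - ov y) (x / y).
Proof. by move=> h; apply: vgeM h _; exact: vgeV. Qed.

Lemma vgeX2 q x : vge q x -> vge (2 * q) (x ^+ 2).
Proof. by move=> h; apply: vgeW (vgeM h h) _; lra. Qed.

Lemma vge_sqrt q x : vge (2 * q) (x ^+ 2) -> vge q x.
Proof. by rewrite /vge sqrf_eq0 => h x0; have := h x0; rewrite ovX2 //; lra. Qed.

Lemma vge1 : vge 0 1. Proof. by move=> _; rewrite ov1. Qed.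

Lemma vge_sign n : vge 0 ((-1) ^+ n).
Proof.
elim: n => [|n IH]; first exact: vge1.
by rewrite exprS mulN1r; apply: vgeN.
Qed.

Lemma vge2 : vge (e ord) 2%:R. Proof. by move=> _. Qed.

Lemma vge_mul2 q x : vge q x -> vge (e ord + q) (2%:R * x).
Proof. by apply: vgeM; exact: vge2. Qed.

Lemma ovD_lt x y : x != 0 -> vgt (ov x) y -> x + y != 0 /\ ov (x + y) = ov x.
Proof.
move=> x0 hy.
have [->|y0] := eqVneq y 0; first by rewrite addr0.
have lt := hy y0.
have xy0 : x + y != 0.
  by apply/eqP => /eqP; rewrite addr_eq0 => /eqP xE; move: lt; rewrite xE ovN ltxx.
split=> //; apply/eqP; rewrite eq_le; apply/andP; split; last first.
  by have := ov_min x0 y0 xy0; rewrite ge_min => /orP[|h] //; apply: le_trans (ltW lt) h.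
have ny0 : - y != 0 by rewrite oppr_eq0.
have := ov_min xy0 ny0; rewrite addrK => /(_ x0); rewrite ovN ge_min => /orP[//|].
by rewrite leNgt lt.
Qed.

Lemma O_vge x : O ord x <-> vge 0 x.
Proof.
rewrite /O /= /Defs.val /vge /ov; case: eqVneq => [->|x0] /=.
  by rewrite leey.
by rewrite lee_fin; split => // /(_ isT).
Qed.

Lemma principalP b x : b != 0 -> principal ord b x <-> vge (ov b) x.
Proof.
move=> b0; split => [[c /O_vge hc <-]|h].
  by apply: vgeW (vgeM (@vge_ov b) hc) _; rewrite addr0.
exists (x / b); last by rewrite mulrCA divff ?mulr1.
by apply/O_vge; apply: vgeW (vge_div h) _; rewrite subrr.
Qed.

Lemma principal0 x : principal ord 0 x <-> x = 0.
Proof.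
split => [[c _ <-]|->]; first by rewrite mul0r.
by exists 0; rewrite ?mulr0 //; apply/O_vge; exact: vge0.
Qed.

Lemma principal_id b : principal ord b b.
Proof. by exists 1; rewrite ?mulr1 //; apply/O_vge; exact: vge1. Qed.

(** Witness form of q <= d(x), as [dgeP] shows for nonzero x: a single representation as a square
    plus a small remainder, which avoids the intersection of ideals in [quad_defect]. *)
Definition dge (x : F) (q : rat) : Prop :=
  exists c b, x = c ^+ 2 + b /\ vge (q + ov x) b.

(** [ord_ideal] uses a generator chosen by [xget]; two generators of one principal ideal divide each
    other, so the choice does not affect the order. *)
Lemma ord_ideal_principal b (I : set F) :
  (forall x, I x <-> principal ord b x) -> ord_ideal ord I = Defs.val ord b.
Proof.
move=> hI; rewrite /ord_ideal.
have IE : I = principal ord b by apply/seteqP; split => x /hI.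
case: (xgetP 0 [set b0 | I = principal ord b0]) => [c cE /=|/(_ b)]; last by [].
rewrite IE => h.
have bc : principal ord c b by rewrite -h; exact: principal_id.
have cb : principal ord b c by rewrite h; exact: principal_id.
have [b0|b0] := eqVneq b 0.
  by move: cb; rewrite b0 => /principal0 ->.
have c0 : c != 0 by apply: contra b0 => /eqP c0; move: bc; rewrite c0 => /principal0 ->.
move/(principalP _ b0): cb => /(_ c0) h1.
move/(principalP _ c0): bc => /(_ b0) h2.
rewrite /Defs.val (negPf b0) (negPf c0); congr (_%:E).
by apply/eqP; rewrite eq_le h1 h2.
Qed.

Definition defects (x : F) : set F := [set b | exists c, x = c ^+ 2 + b].

Lemma d_attained x b : x != 0 -> defects x b ->
  (forall b', defects x b' -> principal ord b' b) ->
  d ord x = Defs.val ord (x^-1 * b).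
Proof.
move=> x0 hb hmax; apply: ord_ideal_principal => y; split.
  case=> z /(_ b hb) [c hc <-] <-; exists c => //; by rewrite mulrA.
case=> c hc <-; exists (b * c); last by rewrite mulrA.
move=> b' /hmax [c' /O_vge hc' <-]; exists (c' * c); last by rewrite mulrA.
by apply/O_vge; rewrite -[0]addr0; apply: vgeM => //; apply/O_vge.
Qed.

Lemma d_unbounded x :
  (forall q, exists2 b, defects x b & vge q b) -> d ord x = +oo%E.
Proof.
move=> h; rewrite /d (@ord_ideal_principal 0) ?/Defs.val ?eqxx // => y; split.
  case=> z hz <-; apply/principal0.
  have [-> | z0] := eqVneq z 0; first by rewrite mulr0.
  have [b hb vb] := h (ov z + 1).
  have [b0|b0] := eqVneq b 0.
    by move: (hz b hb); rewrite b0 => /principal0 ->; rewrite mulr0.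
  move/(principalP _ b0): (hz b hb) => /(_ z0) h1; exfalso; move: (vb b0); lra.
move=> /principal0 ->; exists 0; last by rewrite mulr0.
by move=> b _; exists 0; rewrite ?mulr0 //; apply/O_vge; exact: vge0.
Qed.

(** Orders are integers: if those of the remainders are bounded above, the largest one is
    attained. *)
Lemma defect_dichotomy x :
  (exists2 b, defects x b & forall b', defects x b' -> principal ord b' b) \/
  (forall q, exists2 b, defects x b & vge q b).
Proof.
case: (pselect (defects x 0)) => [h0|h0].
  by right => q; exists 0 => //; exact: vge0.
have nz b : defects x b -> b != 0.
  by move=> hb; apply/eqP => b0; apply: h0; rewrite -b0.
case: (pselect (forall q, exists2 b, defects x b & vge q b)) => [|/existsNP[q hq]].
  by right.
left.
(* Counting down from the bound q: the least n marks the largest order, since distinct orders differ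
   by at least 1. *)
pose P (n : nat) := `[< exists2 b, defects x b & q - n%:R <= ov b >].
have xd : defects x x by exists 0; rewrite expr0n add0r.
have exP : exists n, P n.
  exists (Num.truncn `|q - ov x|).+1; apply/asboolP; exists x => //.
  have /andP[_ h] := truncn_itv (normr_ge0 (q - ov x)).
  by have := ler_norm (q - ov x); move: h; lra.
case: (ex_minnP exP) => n /asboolP[b hb hn] hmin.
exists b => // b' hb'; have b0 := nz _ hb; have b'0 := nz _ hb'.
apply/(principalP _ b'0) => _; rewrite leNgt; apply/negP => lt.
case: n hn hmin => [|n] hn hmin.
  by apply: hq; exists b => // _; move: hn; rewrite subr0.
have /hmin : P n; last by rewrite ltnn.
apply/asboolP; exists b' => //.
have := ov_int_lt lt; move: hn; rewrite -natr1; lra.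
Qed.

Lemma dgeP x q : x != 0 -> (q%:E <= d ord x)%E <-> dge x q.
Proof.
move=> x0; case: (defect_dichotomy x) => [[b hb hmax]|h].
- rewrite (d_attained x0 hb hmax) /Defs.val mulf_eq0 invr_eq0 (negPf x0) /=.
  case: eqVneq => b0.
    rewrite leey; split => // _; case: hb => c ->; exists c, b; rewrite b0; split => //.
    exact: vge0.
  rewrite lee_fin -/(ov _) ovM ?invr_eq0 // ovV //; split => [le|[c [b' [xE vb']]]].
    by case: hb => c xE; exists c, b; split => // _; lra.
  have hb' : defects x b' by exists c.
  have b'0 : b' != 0 by apply: contra b0 => /eqP z; move: (hmax _ hb'); rewrite z => /principal0 ->.
  have /(principalP _ b'0) /(_ b0) := hmax _ hb'; move: (vb' b'0); lra.
rewrite d_unbounded // leey; split => // _.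
by have [b [c xE] vb] := h (q + ov x); exists c, b.
Qed.

Lemma dgeW x q q' : dge x q -> q' <= q -> dge x q'.
Proof. by move=> [c [b [-> h]]] le; exists c, b; split => //; apply: vgeW h _; lra. Qed.

Lemma dge_le0 x q : q <= 0 -> dge x q.
Proof.
by move=> q0; exists 0, x; rewrite expr0n add0r; split => // _; lra.
Qed.

Lemma dge_sq c q : dge (c ^+ 2) q.
Proof. by exists c, 0; rewrite addr0; split => //; exact: vge0. Qed.

(** At levels up to e signs can be ignored; hence the side conditions q <= e below. *)
Lemma dge_N1 : dge (-1) (e ord).
Proof.
exists 1, (- 2%:R); split; first by rewrite expr1n -[2%:R]/(1 + 1); ring.
by apply: vgeN; rewrite ovN1 addr0; exact: vge2.
Qed.

Lemma dge_root_order x q c b : 0 <= q -> x = c ^+ 2 + b -> vge (q + ov x) b ->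
  vge (ov x / 2) c.
Proof.
move=> q0 xE vb; apply: vge_sqrt.
have -> : c ^+ 2 = x - b by rewrite xE addrK.
apply: vgeB; first by apply: vgeW (@vge_ov x) _; lra.
by apply: vgeW vb _; lra.
Qed.

(** The domination principle d(xy) >= min(d(x), d(y)): multiply the two representations. For q > 0
    the roots have at least half the order of x and y, which keeps every cross term small. *)
Lemma dgeM x y q : x != 0 -> y != 0 -> dge x q -> dge y q -> dge (x * y) q.
Proof.
move=> x0 y0 dx dy; have [q0|q0] := leP q 0; first exact: dge_le0.
case: dx dy => c [b [xE vb]] [c' [b' [yE vb']]].
have vc := dge_root_order (ltW q0) xE vb.
have vc' := dge_root_order (ltW q0) yE vb'.
exists (c * c'), (c ^+ 2 * b' + c' ^+ 2 * b + b * b'); split.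
  by rewrite {1}xE {1}yE; ring.
rewrite ovM //; apply: vgeD; first apply: vgeD.
- by apply: vgeW (vgeM (vgeX2 vc) vb') _; lra.
- by apply: vgeW (vgeM (vgeX2 vc') vb) _; lra.
- by apply: vgeW (vgeM vb vb') _; lra.
Qed.

Lemma dge_prod (I : eqType) (r : seq I) (P : pred I) (f : I -> F) q :
  (forall i, i \in r -> P i -> f i != 0 /\ dge (f i) q) ->
  \prod_(i <- r | P i) f i != 0 /\ dge (\prod_(i <- r | P i) f i) q.
Proof.
move=> h; rewrite big_seq_cond.
elim/big_ind: _ => [||i /andP[ir Pi]]; last exact: h.
  by rewrite oner_neq0 -(expr1n _ 2); split => //; exact: dge_sq.
by move=> x y [x0 dx] [y0 dy]; rewrite mulf_neq0 //; split => //; exact: dgeM.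
Qed.

Lemma dge_mul_sq x c q : x != 0 -> c != 0 -> dge (x * c ^+ 2) q -> dge x q.
Proof.
move=> x0 c0 h.
have := @dgeM (x * c ^+ 2) ((c^-1) ^+ 2) q.
rewrite exprVn mulfK ?sqrf_eq0 // mulf_neq0 ?sqrf_eq0 // invr_eq0 sqrf_eq0; apply => //.
by rewrite -exprVn; exact: dge_sq.
Qed.

End Valuation.

(** * Norm groups *)

Section NormGroup.
Context {F : fieldType} (ord : F -> int) (hF : dyadic_local_field ord).
Context (a : seq F) (a_neq0 : forall j, (1 <= j <= size a)%N -> ent a j != 0).

Local Notation ov := (ov ord).
Local Notation vge := (vge ord).
Local Notation dge := (dge ord).
Local Notation RR := (R ord a).
Local Notation ee := (e ord).

(* [alpha_level i al] says [al <= alpha_i], unfolded term by term. *)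
Definition alpha_level (i : nat) (al : rat) : Prop :=
  [/\ (1 <= i < size a)%N,
      al <= (RR i.+1 - RR i) / 2 + ee,
      forall l, (1 <= l <= i)%N -> dge (- ent a l * ent a l.+1) (al - RR i.+1 + RR l) &
      forall l, (i <= l < size a)%N -> dge (- ent a l * ent a l.+1) (al - RR l.+1 + RR i)].

Lemma le_ereal_rat (x y : \bar rat) :
  (forall q, (q%:E <= x)%E -> (q%:E <= y)%E) -> (x <= y)%E.
Proof.
case: x => [x||] h; [exact: h | | exact: leNye].
case: y h => [y||] h; [|by [] |].
- by have := h (y + 1) (leey _); rewrite lee_fin => le; exfalso; lra.
- by have := h 0 (leey _).
Qed.

Lemma bigmine_le (I : eqType) (r : seq I) (f : I -> \bar rat) x i :
  (x <= \big[mine/+oo%E]_(j <- r) f j)%E -> i \in r -> (x <= f i)%E.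
Proof.
elim: r => [|j r IH]; first by rewrite in_nil.
rewrite big_cons le_min in_cons => /andP[h1 h2] /orP[/eqP-> //|ir].
exact: IH.
Qed.

Lemma le_fin_add (q r : rat) (x : \bar rat) : (q%:E <= r%:E + x)%E -> ((q - r)%:E <= x)%E.
Proof.
by case: x => [x||] //=; rewrite ?leey // -EFinD !lee_fin; lra.
Qed.

Lemma alpha_levelP i q : (1 <= i < size a)%N -> (q%:E <= alpha ord a i)%E ->
  alpha_level i q.
Proof.
move=> hi; rewrite /alpha !le_min => /and3P[h0 h1 h2].
have nz l : (1 <= l < size a)%N -> - ent a l * ent a l.+1 != 0.
  by move=> /andP[? ?]; rewrite mulf_neq0 ?oppr_eq0 // a_neq0 //; nlia.
split => // l hl; apply/(dgeP hF); try by apply: nz; move: hi hl; nlia.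
- apply: le_trans (_ : ((q - (RR i.+1 - RR l))%:E <= _)%E); first by rewrite lee_fin; lra.
  apply: le_fin_add; apply: (bigmine_le h1); rewrite mem_index_iota; nlia.
- apply: le_trans (_ : ((q - (RR l.+1 - RR i))%:E <= _)%E); first by rewrite lee_fin; lra.
  apply: le_fin_add; apply: (bigmine_le h2); rewrite mem_index_iota; nlia.
Qed.

(** Telescoping: up to squares, a_j a_(l+1) is (a_j a_l)(-a_l a_(l+1)) times -1, and the sign costs
    only q <= e. *)
Lemma dge_chain q j l : q <= ee -> (1 <= j)%N -> (j <= l <= size a)%N ->
  (forall t, (j <= t < l)%N -> dge (- ent a t * ent a t.+1) q) ->
  dge (ent a j * ent a l) q.
Proof.
move=> qe j1 /andP[]; elim: l => [|l IH]; first by nlia.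
rewrite leq_eqVlt => /orP[/eqP<- _ _|]; first by rewrite -expr2; exact: dge_sq.
rewrite ltnS => jl ls h.
have IH' := IH jl (ltnW ls) (fun t ht => h t ltac:(nlia)).
have aj : ent a j != 0 by apply: a_neq0; nlia.
have al : ent a l != 0 by apply: a_neq0; nlia.
have al' : ent a l.+1 != 0 by apply: a_neq0; nlia.
apply: (dge_mul_sq hF (c := ent a l)); rewrite ?mulf_neq0 //.
have -> : ent a j * ent a l.+1 * ent a l ^+ 2 =
  (ent a j * ent a l) * (- ent a l * ent a l.+1) * (-1) by ring.
have n1 : (-1 : F) != 0 by rewrite oppr_eq0 oner_neq0.
apply: (dgeM hF); rewrite ?mulf_neq0 ?oppr_eq0 ?oner_neq0 //; last exact: dgeW (dge_N1 hF) _.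
apply: (dgeM hF); rewrite ?mulf_neq0 ?oppr_eq0 //; apply: h; nlia.
Qed.

Definition norm_gp (i : nat) (al : rat) (x : F) : Prop :=
  exists X w, [/\ x = ent a i * X ^+ 2 + w, vge 0 X,
    vge ((RR i.+1 - RR i) / 2) X & vge (RR i + al) w].

Lemma vge_ent j : vge (RR j) (ent a j). Proof. exact: vge_ov. Qed.

Section Fixed.
Context (i : nat) (al : rat) (hal : alpha_level i al).
Local Notation G := (norm_gp i al).

Lemma norm_gp_small x : vge (RR i + al) x -> G x.
Proof.
by move=> hx; exists 0, x; rewrite expr0n mulr0 add0r; split => //; exact: vge0.
Qed.

Lemma norm_gp_2scale r x : (RR i + RR i.+1) / 2 <= r -> vge (ee + r) x -> G x.
Proof.
by case: hal => _ h0 _ _ hr hx; apply: norm_gp_small; apply: vgeW hx _; lra.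
Qed.

Lemma norm_gp0 : G 0.
Proof. by apply: norm_gp_small; exact: vge0. Qed.

(** The cross term 2 a_i X Y has order at least e + (R_i + R_(i+1))/2: one factor is bounded by 0,
    the other by (R_(i+1) - R_i)/2. The first term of alpha_i makes this at least R_i + al. *)
Lemma norm_gpD x y : G x -> G y -> G (x + y).
Proof.
case: hal => _ h0 _ _ [X [w [-> X0 X1 hw]]] [Y [w' [-> Y0 Y1 hw']]].
exists (X + Y), (w + w' - 2%:R * (ent a i * (X * Y))); split; first by ring.
- exact: (vgeD hF).
- exact: (vgeD hF).
- apply: (vgeB hF); first exact: (vgeD hF).
  by apply: vgeW (vge_mul2 hF (vgeM hF (@vge_ent i) (vgeM hF X0 Y1))) _; lra.
Qed.

Lemma norm_gpN x : G x -> G (- x).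
Proof.
case: hal => _ h0 _ _ [X [w [-> X0 X1 hw]]].
exists X, (- w - 2%:R * (ent a i * (X * X))); split => //; first by ring.
apply: (vgeB hF); first exact: (vgeN hF).
by apply: vgeW (vge_mul2 hF (vgeM hF (@vge_ent i) (vgeM hF X0 X1))) _; lra.
Qed.

Lemma norm_gpZ c x : vge 0 c -> G x -> G (c ^+ 2 * x).
Proof.
move=> c0 [X [w [-> X0 X1 hw]]].
exists (c * X), (c ^+ 2 * w); split; first by ring.
- by apply: vgeW (vgeM hF c0 X0) _; lra.
- by apply: vgeW (vgeM hF c0 X1) _; lra.
- by apply: vgeW (vgeM hF (vgeX2 hF c0) hw) _; lra.
Qed.

(** Dividing a_i a_j = y^2 + t by a_i turns a_j into a_i times a square plus a remainder; the three
    inequalities are the bounds that G imposes on c y / a_i and c^2 t / a_i. *)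
Lemma norm_gp_transfer j q lam c : (1 <= j <= size a)%N ->
  0 <= q -> dge (ent a i * ent a j) q -> vge lam c ->
  RR i <= RR j + 2 * lam -> RR i.+1 <= RR j + 2 * lam ->
  RR i + al <= RR j + 2 * lam + q -> G (c ^+ 2 * ent a j).
Proof.
case: hal => hi _ _ _ hj q0 [y [t [yE vt]]] vc h1 h2 h3.
have ai : ent a i != 0 by apply: a_neq0; nlia.
have aj : ent a j != 0 by apply: a_neq0; nlia.
have vy := dge_root_order hF q0 yE vt.
have vE : ov (ent a i * ent a j) = RR i + RR j by rewrite (ovM hF).
exists (c * y / ent a i), (c ^+ 2 * t / ent a i); split.
- have -> : ent a j = (y ^+ 2 + t) / ent a i by rewrite -yE mulrC mulKf.
  by field.
- apply: vgeW (vge_div hF (vgeM hF vc vy)) _; rewrite vE -/(R ord a i); lra.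
- apply: vgeW (vge_div hF (vgeM hF vc vy)) _; rewrite vE -/(R ord a i); lra.
- apply: vgeW (vge_div hF (vgeM hF (vgeX2 hF vc) vt)) _; rewrite vE -/(R ord a i); lra.
Qed.

(* A block of the splitting occupies the indices j..j' with j' = j or j' = j+1;
   RR j is the order of its norm and RR j' that of the norm of its dual, up to
   scaling. *)
Definition block_pos (j j' : nat) : Prop :=
  [/\ (1 <= j <= j')%N, (j' <= j.+1)%N, (j' <= size a)%N,
      forall l, (1 <= l <= j')%N -> RR l <= RR j &
      forall l, (j <= l <= size a)%N -> RR j' <= RR l].

(** [lam] bounds the coordinates, along a block of scale order (R_j + R_j')/2, of a vector of
    L^(p^r). For i < j monotonicity suffices; otherwise R_j + 2 lam >= 2r - R_j' >= R_i + R_(i+1) -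
    R_j', and R_j' is at most R_i and R_(i+1). *)
Lemma norm_gp_block j j' r lam c : block_pos j j' -> (RR i + RR i.+1) / 2 <= r ->
  0 <= lam -> r - (RR j + RR j') / 2 <= lam -> vge lam c ->
  [/\ G (c ^+ 2 * ent a j), RR i <= RR j + 2 * lam & RR i.+1 <= RR j + 2 * lam].
Proof.
case: (hal) => hi h0 h1 h2 [hj jj' j's P1 P2] hr l0 l1 vc.
have [T1 T2] : RR i <= RR j + 2 * lam /\ RR i.+1 <= RR j + 2 * lam.
  have [ij|ji] := ltnP i j.
    by have := P1 i ltac:(nlia); have := P1 i.+1 ltac:(nlia); lra.
  have [ij'|ji'] := leqP j' i.
    by have := P2 i ltac:(nlia); have := P2 i.+1 ltac:(nlia); lra.
  have ij : i = j by nlia.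
  have j'E : j' = i.+1 by nlia.
  move: l1 hr; rewrite j'E ij; have := P2 j ltac:(nlia); rewrite j'E ij; lra.
split => //.
(* The defect of a_i a_j that the transfer still requires, cut off at 0 because the order of the
   root is controlled only for q >= 0. *)
pose q := Num.max 0 (RR i + al - (RR j + 2 * lam)).
have q0 : 0 <= q by rewrite le_max lexx.
have q1 : RR i + al <= RR j + 2 * lam + q.
  suff : RR i + al - (RR j + 2 * lam) <= q by lra.
  by rewrite le_max lexx orbT.
have qe : q <= ee.
  by rewrite ge_max (ltW (ov2_gt0 hF)) /=; lra.
apply: (norm_gp_transfer (q := q) (lam := lam)) => //; first by nlia.
have dq x p : dge x p -> RR i + al - (RR j + 2 * lam) <= p -> dge x q.
  move=> hx hp; rewrite /q; case: (lerP 0 (RR i + al - (RR j + 2 * lam))) => _.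
    exact: dgeW hx hp.
  exact: dge_le0.
have [ij|ji] := leqP i j.
- apply: dge_chain => //; [nlia|nlia|] => t ht.
  by apply: dq (h2 t ltac:(nlia)) _; have := P1 t.+1 ltac:(nlia); lra.
- rewrite mulrC; apply: dge_chain => //; [nlia|nlia|] => t ht.
  by apply: dq (h1 t ltac:(nlia)) _; have := P2 t ltac:(nlia); lra.
Qed.

End Fixed.

(** The block has Gram matrix (a_j, b; b, c), and a_j a_(j+1) is its determinant. As R_(j+1) < R_j,
    the diagonal entries have order greater than [ov b], so b generates the scale. The last
    inequality says that 2b lies in the ideal generated by a_j. *)
Definition binary_gram (j : nat) (b c : F) : Prop :=
  [/\ ent a j * ent a j.+1 = ent a j * c - b ^+ 2, RR j.+1 < RR j, vge (RR j) c,
      b != 0 & ov b = (RR j + RR j.+1) / 2] /\ RR j <= ee + ov b.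

(** Write b^2 - a_j c = -a_j a_(j+1) = y^2 + t and y = b + h. Then a_j c = -h^2 - 2bh - t, so c is
    a_j (h / a_j)^2 up to t / a_j and a multiple of 2. *)
Lemma binary_diag j b c q : (1 <= j < size a)%N -> binary_gram j b c -> 0 <= q ->
  dge (- ent a j * ent a j.+1) q ->
  exists k w w', [/\ c = ent a j * k ^+ 2 + w + w', vge 0 k, vge (RR j.+1 + q) w &
    vge (ee + ov b) w'].
Proof.
move=> hj [[dE lt vc b0 vb] le] q0 [y [t [yE vt]]].
have aj : ent a j != 0 by apply: a_neq0; nlia.
have aj' : ent a j.+1 != 0 by apply: a_neq0; nlia.
have vE : ov (- ent a j * ent a j.+1) = RR j + RR j.+1.
  by rewrite (ovM hF) ?oppr_eq0 // (ovN hF).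
(* For small q the whole of c already has the order required of w. *)
have [ql|ql] := ltP q (RR j - RR j.+1).
  exists 0, c, 0; rewrite expr0n mulr0 add0r addr0; split => //; try exact: vge0.
  by apply: vgeW vc _; lra.
pose h := y - b.
have acE : ent a j * c = - h ^+ 2 - 2%:R * b * h - t.
  have -> : ent a j * c = b ^+ 2 - (y ^+ 2 + t) by rewrite -yE mulNr dE; ring.
  by rewrite /h; ring.
have hc : vge (2 * RR j) (h ^+ 2 + 2%:R * b * h).
  have -> : h ^+ 2 + 2%:R * b * h = - (ent a j * c) - t by rewrite acE; ring.
  apply: (vgeB hF); first by apply: (vgeN hF); apply: vgeW (vgeM hF (@vge_ent j) vc) _; lra.
  by apply: vgeW vt _; rewrite vE; lra.
have vh : vge (RR j) h.
  (* If ord h < R_j, then R_j <= e + ord b gives ord(2bh) > ord(h^2), so h^2 dominates and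
     contradicts [hc]. *)
  move=> h0; rewrite leNgt; apply/negP => hlt.
  have h20 : h ^+ 2 != 0 by rewrite sqrf_eq0.
  have v2 : vgt ord (ov (h ^+ 2)) (2%:R * b * h).
    apply: (@vge_vgt _ _ (ee + (ov b + ov h))).
      by rewrite -mulrA; apply: (vge_mul2 hF); apply: (vgeM hF) => _.
    by rewrite (ovX2 hF) //; lra.
  have [s0 sE] := ovD_lt hF h20 v2.
  by have := hc s0; rewrite sE (ovX2 hF) //; lra.
exists (h / ent a j), (- t / ent a j), (- 2%:R * h * (h + b) / ent a j); split.
- by apply: (mulfI aj); rewrite acE; field.
- by apply: vgeW (vge_div hF vh) _; rewrite -/(R ord a j); lra.
- by apply: vgeW (vge_div hF (vgeN hF vt)) _; rewrite vE -/(R ord a j); lra.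
- have vhb : vge (ov b) (h + b).
    by apply: (vgeD hF); [apply: vgeW vh _; lra | move=> _].
  have -> : - 2%:R * h * (h + b) / ent a j = - (2%:R * (h / ent a j * (h + b))) by ring.
  apply: (vgeN hF); apply: vgeW (vge_mul2 hF (vgeM hF (vge_div hF vh) vhb)) _.
  by rewrite -/(R ord a j); lra.
Qed.

(** Expanding the second diagonal entry by [binary_diag] leaves two terms a_j times a square,
    covered by [norm_gp_block], a remainder of order at least R_i + al, and terms in 2p^r. *)
Lemma norm_gp_binary i al j b z r lam c d : alpha_level i al ->
  block_pos j j.+1 -> binary_gram j b z ->
  (RR i + RR i.+1) / 2 <= r -> 0 <= lam -> r - ov b <= lam ->
  vge lam c -> vge lam d ->
  let x := ent a j * c ^+ 2 + 2%:R * b * c * d + z * d ^+ 2 in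
  [/\ norm_gp i al x, vge (RR i) x & vge (RR i.+1) x].
Proof.
move=> hal pos bin hr l0 l1 vc vd x.
have l1' : r - (RR j + RR j.+1) / 2 <= lam by case: bin => [[_ _ _ _ <-]].
have [G1 T1 T2] := norm_gp_block hal pos hr l0 l1' vc.
have vx : vge (RR j + 2 * lam) x.
  case: bin => [[_ _ vz _ _] le]; rewrite /x; apply: (vgeD hF); first apply: (vgeD hF).
  - by apply: vgeW (vgeM hF (@vge_ent j) (vgeX2 hF vc)) _; lra.
  - rewrite -!mulrA; apply: vgeW (vge_mul2 hF (vgeM hF (@vge_ov _ _ b) (vgeM hF vc vd))) _; lra.
  - by apply: vgeW (vgeM hF vz (vgeX2 hF vd)) _; lra.
split; [| exact: vgeW vx _ | exact: vgeW vx _].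
case: (hal) => hi h0 h1 h2; case: (pos) => hj _ js _ _.
pose q := Num.max 0 (RR i + al - 2 * lam - RR j.+1).
have q0 : 0 <= q by rewrite le_max lexx.
have q1 : RR i + al <= RR j.+1 + 2 * lam + q.
  suff : RR i + al - 2 * lam - RR j.+1 <= q by lra.
  by rewrite le_max lexx orbT.
have dq : dge (- ent a j * ent a j.+1) q.
  rewrite /q; case: (lerP 0 _) => _; last exact: dge_le0.
  have [ij|ji] := leqP i j.
    by apply: dgeW (h2 j ltac:(nlia)) _; lra.
  by apply: dgeW (h1 j ltac:(nlia)) _; lra.
have hj' : (1 <= j < size a)%N by nlia.
have [k [w [w' [zE vk vw vw']]]] := binary_diag hj' bin q0 dq.
have vdk : vge lam (d * k) by apply: vgeW (vgeM hF vd vk) _; lra.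
have [G2 _ _] := norm_gp_block hal pos hr l0 l1' vdk.
have -> : x = c ^+ 2 * ent a j + (d * k) ^+ 2 * ent a j + d ^+ 2 * w
              + 2%:R * b * c * d + d ^+ 2 * w' by rewrite /x zE; ring.
apply: (norm_gpD hal); [apply: (norm_gpD hal); [apply: (norm_gpD hal); [exact: (norm_gpD hal)|]|]|].
- by apply: norm_gp_small; apply: vgeW (vgeM hF (vgeX2 hF vd) vw) _; lra.
- apply: (norm_gp_2scale hal hr); rewrite -!mulrA.
  by apply: vgeW (vge_mul2 hF (vgeM hF (@vge_ov _ _ b) (vgeM hF vc vd))) _; lra.
- by apply: (norm_gp_2scale hal hr); apply: vgeW (vgeM hF (vgeX2 hF vd) vw') _; lra.
Qed.

End NormGroup.

(** * Determinants of perturbed Gram matrices *)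

Section IntegralMatrices.
Context {F : fieldType} (ord : F -> int) (hF : dyadic_local_field ord).
Local Notation ov := (ov ord).
Local Notation vge := (vge ord).

Definition mxvge m n (q : rat) (A : 'M[F]_(m, n)) : Prop := forall i j, vge q (A i j).

Lemma mxvge_at m n q q' (A : 'M_(m, n)) i j : mxvge q A -> q' <= q -> vge q' (A i j).
Proof. by move=> hA; apply: vgeW (hA i j). Qed.

Lemma mxvgeM m n p q q' (A : 'M_(m, n)) (B : 'M_(n, p)) :
  mxvge q A -> mxvge q' B -> mxvge (q + q') (A *m B).
Proof. by move=> hA hB i j; rewrite mxE; apply: (vge_sum hF) => k _; exact: vgeM. Qed.

Lemma mxvgeD m n q (A B : 'M_(m, n)) : mxvge q A -> mxvge q B -> mxvge q (A + B).
Proof. by move=> hA hB i j; rewrite mxE; apply: (vgeD hF). Qed.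

Lemma mxvgeN m n q (A : 'M_(m, n)) : mxvge q A -> mxvge q (- A).
Proof. by move=> hA i j; rewrite mxE; apply: (vgeN hF). Qed.

Lemma mxvge_tr m n q (A : 'M_(m, n)) : mxvge q A -> mxvge q A^T.
Proof. by move=> hA i j; rewrite mxE. Qed.

Lemma vge_prod_ord n q (f : 'I_n -> F) : (forall i, vge q (f i)) ->
  vge (n%:R * q) (\prod_(i < n) f i).
Proof.
elim: n f => [|n IH] f hf; first by rewrite big_ord0 mul0r; exact: (vge1 hF).
by rewrite big_ord_recl; apply: vgeW (vgeM hF (hf _) (IH _ _)) _ => //; rewrite -natr1; lra.
Qed.

Lemma det_vge n q (A : 'M_n) : mxvge q A -> vge (n%:R * q) (\det A).
Proof.
move=> hA; rewrite /determinant; apply: (vge_sum hF) => s _.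
have vp : vge (n%:R * q) (\prod_i A i (s i)) by apply: vge_prod_ord => i; exact: hA.
by apply: vgeW (vgeM hF (@vge_sign _ _ hF _) vp) _; rewrite add0r.
Qed.

(** Cramer's rule. The hypotheses express that A is modular of scale order q, so its dual has scale
    order -q. *)
Lemma invmx_vge n q (A : 'M_n) : mxvge q A -> \det A != 0 -> ov (\det A) = n%:R * q ->
  mxvge (- q) (invmx A).
Proof.
case: n A => [|n] A hA A0 vA i j; first by case: i.
rewrite /invmx unitmxE unitfE A0 !mxE mulrC /cofactor.
have vm : vge (n%:R * q) (\det (row' j (col' i A))).
  by apply: det_vge => k l; rewrite !mxE; exact: hA.
apply: vgeW (vge_div hF (vgeM hF (@vge_sign _ _ hF (j + i)) vm)) _.
by rewrite vA -natr1; lra.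
Qed.

Lemma det_near1 n (A : 'M[F]_n) : (forall i j, vgt ord 0 (A i j)) ->
  vgt ord 0 (\det (1%:M + A) - 1).
Proof.
move=> hA.
(* Integral and congruent modulo the maximal ideal: a relation that the Leibniz formula
   preserves. *)
pose P (x y : F) := [/\ vge 0 x, vge 0 y & vgt ord 0 (x - y)].
have PD x y x' y' : P x y -> P x' y' -> P (x + x') (y + y').
  move=> [h1 h2 h3] [h1' h2' h3']; split; try exact: (vgeD hF).
  have -> : x + x' - (y + y') = (x - y) + (x' - y') by ring.
  exact: (vgtD hF).
have PM x y x' y' : P x y -> P x' y' -> P (x * x') (y * y').
  move=> [h1 h2 h3] [h1' h2' h3']; split.
  - by apply: vgeW (vgeM hF h1 h1') _; rewrite addr0.
  - by apply: vgeW (vgeM hF h2 h2') _; rewrite addr0.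
  have -> : x * x' - y * y' = x * (x' - y') + y' * (x - y) by ring.
  by rewrite -[0]addr0; apply: (vgtD hF); exact: (vgtM hF).
have P11 x : vge 0 x -> P x x by move=> hx; split=> //; rewrite subrr /vgt eqxx.
have P00 : P 0 0 by apply: P11; exact: vge0.
suff [] : P (\det (1%:M + A)) (\det (1%:M : 'M_n)) by rewrite det1.
rewrite /determinant; apply: (big_ind2 P) => // s _.
apply: (PM); first by apply: P11; exact: (vge_sign hF).
apply: (big_ind2 P) => [||i _]; [by apply: P11; exact: (vge1 hF) | exact: PM |].
rewrite !mxE; case: (i == s i); rewrite ?mulr1n ?mulr0n ?add0r; last first.
  by split; rewrite ?subr0; [apply: vgt_vge | exact: vge0 | ].
split; [| exact: (vge1 hF) | by rewrite addrAC subrr add0r].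
by apply: (vgeD hF); [exact: (vge1 hF) | apply: vgt_vge].
Qed.

Lemma congr_diag n p (A : 'M[F]_n) (C : 'M_(n, p)) i :
  (C^T *m A *m C) i i = ((col i C)^T *m A *m col i C) 0 0.
Proof.
rewrite tr_col -row_mul mxE [in RHS]mxE; apply: eq_bigr => k _.
by congr (_ * _); rewrite !mxE.
Qed.

Lemma mx11_congr n (A : 'M[F]_n) (u : 'cV_n) :
  (u^T *m A *m u) 0 0 = \sum_i \sum_j u j 0 * A j i * u i 0.
Proof.
rewrite mxE; apply: eq_bigr => i _; rewrite mxE mulr_suml.
by apply: eq_bigr => j _; rewrite mxE.
Qed.

End IntegralMatrices.

(** * Stability of block determinants under small perturbations *)

Section Perturbation.
Context {F : fieldType} (ord : F -> int) (hF : dyadic_local_field ord).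
Context (a : seq F) (a_neq0 : forall j, (1 <= j <= size a)%N -> ent a j != 0).

Local Notation ov := (ov ord).
Local Notation vge := (vge ord).
Local Notation dge := (dge ord).
Local Notation RR := (R ord a).
Local Notation ee := (e ord).

Context (m : nat) (al r : rat) (hal : alpha_level ord a m al) (al_gt0 : 0 < al).
Context (R_jump : RR m < RR m.+1) (hr : (RR m + RR m.+1) / 2 <= r).
Context (hn : RR m.+1 <= ee + r).

Local Ltac lras := move: (al_gt0) (R_jump) (hr) (hn) => *; lra.

Local Notation tau := ((RR m.+1 - RR m) / 2).
Local Notation G := (norm_gp ord a m al).

(** The remainder w of an element of G has order at least R_m + al only, possibly below R_(m+1). The
    second bound controls the product of two diagonal perturbations in a binary block. *)
Definition gm (x : F) : Prop := G x /\ vge (RR m.+1) x.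

Lemma gmD x y : gm x -> gm y -> gm (x + y).
Proof. by move=> [h1 h2] [h3 h4]; split; [apply: (norm_gpD hF hal) | apply: (vgeD hF)]. Qed.

Lemma gmN x : gm x -> gm (- x).
Proof. by move=> [h1 h2]; split; [apply: (norm_gpN hF hal) | apply: (vgeN hF)]. Qed.

Lemma gmZ c x : vge 0 c -> gm x -> gm (c ^+ 2 * x).
Proof.
move=> hc [h1 h2]; split; first exact: (norm_gpZ hF).
by apply: vgeW (vgeM hF (vgeX2 hF hc) h2) _; lras.
Qed.

Lemma gm_2scale x : vge r x -> gm (2%:R * x).
Proof.
move=> hx; have h2 := vge_mul2 hF hx; split; first exact: (norm_gp_2scale hal hr).
exact: vgeW h2 hn.
Qed.

Lemma gm0 : gm 0. Proof. by split; [exact: norm_gp0 | exact: vge0]. Qed.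

Definition pert n (E : 'M[F]_n) : Prop :=
  [/\ E^T = E, mxvge ord r E & forall i, gm (E i i)].

Lemma pertB n (E E' : 'M_n) : pert E -> pert E' -> pert (E - E').
Proof.
move=> [s v g] [s' v' g']; split.
- by rewrite raddfB /= s s'.
- by apply: (mxvgeD hF) => //; exact: (mxvgeN hF).
- by move=> i; rewrite !mxE; apply: gmD => //; exact: gmN.
Qed.

(** In the standard basis the value is a sum of squares times diagonal entries, plus cross terms in
    2p^r, which [gm] absorbs. *)
Lemma pert_quad n (E : 'M_n) (u : 'cV_n) : pert E -> mxvge ord 0 u ->
  gm ((u^T *m E *m u) 0 0).
Proof.
move=> [s v g] hu.
pose P (w : 'cV[F]_n) := mxvge ord 0 w /\ gm ((w^T *m E *m w) 0 0).
suff [] : P u by [].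
rewrite (matrix_sum_delta u); elim/big_ind: _ => [|w w' [h1 h2] [h3 h4]|i _].
- split; first by move=> i j; rewrite mxE; exact: vge0.
  by rewrite mulmx0 mxE; exact: gm0.
- split; first exact: (mxvgeD hF).
  have -> : ((w + w')^T *m E *m (w + w')) 0 0 =
     (w^T *m E *m w) 0 0 + (w'^T *m E *m w') 0 0 + 2%:R * (w^T *m E *m w') 0 0.
    have -> : (w^T *m E *m w') 0 0 = (w'^T *m E *m w) 0 0.
      by rewrite -[w'^T *m E *m w]trmxK [in RHS]mxE !trmx_mul trmxK s mulmxA.
    rewrite [(w + w')^T]raddfD /= !mulmxDl !mulmxDr !mxE.
    have -> : (\sum_j (w^T *m E) 0 j * w' j 0) = (\sum_j (w'^T *m E) 0 j * w j 0).
      transitivity ((w^T *m E *m w') 0 0); first by rewrite mxE.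
      transitivity ((w'^T *m E *m w) 0 0); last by rewrite mxE.
      by rewrite -[w'^T *m E *m w]trmxK [in RHS]mxE !trmx_mul trmxK s mulmxA.
    ring.
  apply: gmD; first exact: gmD.
  apply: gm_2scale; apply: mxvge_at (mxvgeM hF (mxvgeM hF (mxvge_tr h1) v) h3) _; lras.
- rewrite big_ord1; split.
    move=> k l; rewrite !mxE; apply: vgeW (vgeM hF (hu i 0) _) (_ : 0 + 0 >= _); last by lras.
    by case: (_ && _); [exact: (vge1 hF) | exact: vge0].
  rewrite [(u i 0 *: _)^T]linearZ /= -!scalemxAl -scalemxAr scalerA mxE -expr2.
  apply: gmZ => //; rewrite trmx_delta -rowE mxE (bigD1 i) //= !mxE !eqxx mulr1.
  rewrite big1 ?addr0 // => k ki; rewrite !mxE (negPf ki) mulr0 //.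
Qed.

Lemma pert_congr n p (E : 'M_n) (C : 'M_(n, p)) : pert E -> mxvge ord 0 C ->
  pert (C^T *m E *m C).
Proof.
move=> hE hC; case: (hE) => s v g; split.
- by rewrite !trmx_mul trmxK s mulmxA.
- by move=> i j; apply: mxvge_at (mxvgeM hF (mxvgeM hF (mxvge_tr hC) v) hC) _; lras.
move=> i; rewrite congr_diag.
by apply: pert_quad => // k l; rewrite mxE.
Qed.

Definition stable_det n (A : 'M[F]_n) : Prop :=
  \det A != 0 /\
  forall E, pert E -> \det (A + E) != 0 /\ dge (\det A * \det (A + E)) al.

(** The second clause is closure under Schur complements, v being the off-diagonal block of a
    perturbation. *)
Definition admissible p (A : 'M[F]_p) : Prop :=
  stable_det A /\
  forall E q (v : 'M_(p, q)), pert E -> mxvge ord r v ->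
    pert (v^T *m invmx (A + E) *m v).

(* The Schur complement of a perturbed admissible block perturbs the rest by a
   matrix of the same kind. *)
Lemma stable_det_block p n (A : 'M_p) (M : 'M_n) : admissible A -> stable_det M ->
  stable_det (block_mx A 0 0 M).
Proof.
move=> [[A0 hA] sA] [M0 hM]; split; first by rewrite det_ublock mulf_neq0.
move=> E; rewrite -[E]submxK; set E1 := ulsubmx E; set E2 := ursubmx E.
set E3 := dlsubmx E; set E4 := drsubmx E => hE; case: (hE) => symE vE gE.
have [s1 s3 s4] : [/\ E1^T = E1, E2^T = E3 & E4^T = E4].
  by move: symE; rewrite tr_block_mx => /eq_block_mx[].
have p1 : pert E1.
  split => // [i j|i]; first by have := vE (lshift n i) (lshift n j); rewrite block_mxEul.
  by have := gE (lshift n i); rewrite block_mxEul.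
have p4 : pert E4.
  split => // [i j|i]; first by have := vE (rshift p i) (rshift p j); rewrite block_mxEdr.
  by have := gE (rshift p i); rewrite block_mxEdr.
have v2 : mxvge ord r E2.
  by move=> i j; have := vE (lshift n i) (rshift p j); rewrite block_mxEur.
have [K0 hK] := hA _ p1; set K := A + E1 in K0 hK *.
have uK : K \in unitmx by rewrite unitmxE unitfE.
pose S := E4 - E2^T *m invmx K *m E2.
have pS : pert S by apply: pertB => //; exact: sA.
have [S0 hS] := hM _ pS.
have detE : \det (block_mx A 0 0 M + block_mx E1 E2 E3 E4) = \det K * \det (M + S).
  rewrite add_block_mx !add0r -/K -s3.
  have -> : block_mx K E2 E2^T (M + E4) =
      block_mx 1%:M 0 (E2^T *m invmx K) 1%:M *m block_mx K E2 0 (M + S).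
    rewrite mulmx_block !mul1mx !mul0mx !addr0 mulmxKV //.
    by rewrite /S; congr block_mx; rewrite [RHS]addrC -addrA subrK.
  by rewrite det_mulmx det_lblock det_ublock !det1 !mul1r.
rewrite detE mulf_neq0 //; split => //; rewrite det_ublock mulrACA.
by apply: (dgeM hF) => //; rewrite mulf_neq0.
Qed.

(** Here s is the scale order of the block. With K = A + E and w = K^-1 v one has v^T K^-1 v = w^T K
    w, where w has order at least r - s. The part w^T A w is covered by the last hypothesis, and w^T
    E w is a congruence transform of E. *)
Lemma admissible_intro p (A : 'M_p) s : A^T = A -> \det A != 0 -> s < r ->
  (forall E, pert E -> [/\ \det (A + E) != 0, dge (\det A * \det (A + E)) al &
      mxvge ord (- s) (invmx (A + E))]) ->
  (forall w : 'cV_p, mxvge ord (r - s) w -> gm ((w^T *m A *m w) 0 0)) ->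
  admissible A.
Proof.
move=> symA A0 sr h1 h2; split; first by split => // E /h1[].
move=> E q v hE hv; have [K0 _ vK] := h1 _ hE; case: (hE) => symE vE gE.
have uK : A + E \in unitmx by rewrite unitmxE unitfE.
set K := A + E in K0 vK uK *.
have symK : K^T = K by rewrite raddfD /= symA symE.
pose w := invmx K *m v.
have vw : mxvge ord (r - s) w.
  by move=> i j; apply: mxvge_at (mxvgeM hF vK hv) _; lras.
have wE : v^T *m invmx K *m v = w^T *m A *m w + w^T *m E *m w.
  rewrite -mulmxDl -mulmxDr -/K /w trmx_mul trmx_inv symK.
  by rewrite mulmxKV // mulmxA.
have pE : pert (w^T *m E *m w).
  by apply: pert_congr => // i j; apply: vgeW (vw i j) _; lras.
split.
- by rewrite !trmx_mul trmxK trmx_inv symK mulmxA.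
- move=> i j; apply: mxvge_at (mxvgeM hF (mxvgeM hF (mxvge_tr hv) vK) hv) _; lras.
move=> i; rewrite wE mxE; apply: gmD; last by case: pE.
rewrite congr_diag; by apply: h2 => k l; rewrite mxE.
Qed.

(** The shape of G divided by a_m, in which the relative perturbations of block determinants are
    measured. *)
Definition near_sq (x : F) : Prop :=
  exists X w, [/\ x = X ^+ 2 + w, vge tau X & vge al w].

Lemma near_sqD x y : near_sq x -> near_sq y -> near_sq (x + y).
Proof.
case: (hal) => _ h0 _ _ [X [w [-> X0 hw]]] [Y [w' [-> Y0 hw']]].
exists (X + Y), (w + w' - 2%:R * (X * Y)); split; first by ring.
  exact: (vgeD hF).
apply: (vgeB hF); first exact: (vgeD hF).
by apply: vgeW (vge_mul2 hF (vgeM hF X0 Y0)) _; lras.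
Qed.

Lemma near_sqN x : near_sq x -> near_sq (- x).
Proof.
case: (hal) => _ h0 _ _ [X [w [-> X0 hw]]].
exists X, (- w - 2%:R * (X * X)); split => //; first by ring.
apply: (vgeB hF); first exact: (vgeN hF).
by apply: vgeW (vge_mul2 hF (vgeM hF X0 X0)) _; lras.
Qed.

Lemma near_sqZ c x : vge 0 c -> near_sq x -> near_sq (c ^+ 2 * x).
Proof.
move=> c0 [X [w [-> X0 hw]]].
exists (c * X), (c ^+ 2 * w); split; first by ring.
- by apply: vgeW (vgeM hF c0 X0) _; lras.
- by apply: vgeW (vgeM hF (vgeX2 hF c0) hw) _; lras.
Qed.

Lemma near_sq_small x : vge al x -> near_sq x.
Proof. by move=> h; exists 0, x; rewrite expr0n add0r; split => //; exact: vge0. Qed.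

(** The cross term 2uX has order at least e + (R_(m+1) - R_m)/2, the first term of alpha_m;
    positivity of al and of R_(m+1) - R_m keeps the sum a unit. *)
Lemma near_sq_unit u x : u != 0 -> ov u = 0 -> near_sq x ->
  u ^+ 2 + x != 0 /\ dge (u ^+ 2 + x) al.
Proof.
case: (hal) => _ h0 _ _ u0 vu [X [w [-> X0 hw]]].
have vX : vgt ord (ov (u ^+ 2)) (X ^+ 2 + w).
  rewrite (ovX2 hF) // vu mulr0; apply: (vgtD hF).
    by apply: vge_vgt (vgeX2 hF X0) _; lras.
  exact: vge_vgt hw _.
have u20 : u ^+ 2 != 0 by rewrite sqrf_eq0.
have [nz vE] := ovD_lt hF u20 vX; split => //.
exists (u + X), (w - 2%:R * (u * X)); split; first by ring.
rewrite vE (ovX2 hF) // vu mulr0 addr0; apply: (vgeB hF) => //.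
by apply: vgeW (vge_mul2 hF (vgeM hF (@vge_ov _ _ u) X0)) _; rewrite vu; lras.
Qed.

(** Since a_j' a_m = y^2 + t, dividing by a_j' instead of a_m changes f only by a square and a small
    term. Each link l of the chain from j' to m is strong enough because R_j' <= R_l. *)
Lemma near_sq_quot j j' f : block_pos ord a j j' -> (j' <= m)%N -> G f ->
  near_sq (f / ent a j').
Proof.
case: (hal) => hm h0 h1 _ [hj jj' j's P1 P2] j'm [X [w [-> X0 X1 vw]]].
have aj : ent a j' != 0 by apply: a_neq0; nlia.
have am : ent a m != 0 by apply: a_neq0; nlia.
have Rm := P2 m ltac:(nlia).
pose q := Num.max 0 (al - RR m.+1 + RR j').
have q0 : 0 <= q by rewrite le_max lexx.
have q1 : al <= RR m.+1 - RR j' + q.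
  suff : al - RR m.+1 + RR j' <= q by lras.
  by rewrite le_max lexx orbT.
have qe : q <= ee by rewrite ge_max (ltW (ov2_gt0 hF)) /=; lras.
have [y [t [yE vt]]] : dge (ent a j' * ent a m) q.
  apply: (dge_chain hF a_neq0) => //; [nlia|nlia|] => l hl.
  rewrite /q; case: (lerP 0 _) => _; last exact: dge_le0.
  apply: dgeW (h1 l ltac:(nlia)) _.
  have [->|jl] := eqVneq l j'; first by lras.
  have [ll|ll] := leqP j l; first by have := P2 l ltac:(nlia); lras.
  by nlia.
have vE : ov (ent a j' * ent a m) = RR j' + RR m by rewrite (ovM hF).
have vy := dge_root_order hF q0 yE vt.
exists (y * X / ent a j'), (t * X ^+ 2 / ent a j' ^+ 2 + w / ent a j'); split.
- have -> : ent a m = (y ^+ 2 + t) / ent a j' by rewrite -yE mulrC mulKf.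
  by field.
- by apply: vgeW (vge_div hF (vgeM hF vy X1)) _; rewrite vE -/(R ord a j'); lras.
- apply: (vgeD hF).
    apply: vgeW (vge_div hF (vgeM hF vt (vgeX2 hF X1))) _.
    by rewrite (ovX2 hF) // vE -/(R ord a j'); lras.
  by apply: vgeW (vge_div hF vw) _; rewrite -/(R ord a j'); lras.
Qed.

Lemma admissible_unary j : block_pos ord a j j -> (j <= m)%N -> RR j < r ->
  admissible ((ent a j)%:M : 'M_1).
Proof.
move=> pos jm jr; case: (pos) => hj _ js _ P2.
have aj : ent a j != 0 by apply: a_neq0; nlia.
have detA : \det ((ent a j)%:M : 'M_1) = ent a j by rewrite det_mx11 mxE eqxx.
apply: (@admissible_intro _ _ (RR j)) => //; first by rewrite tr_scalar_mx.
- by rewrite detA.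
- move=> E [_ vE gE]; have [Gf vf] := gE 0; set f := E 0 0 in Gf vf.
  have dE : \det ((ent a j)%:M + E) = ent a j + f by rewrite det_mx11 !mxE eqxx.
  have ns := near_sq_quot pos jm Gf.
  have [nz dg] := near_sq_unit (oner_neq0 _) (ov1 hF) ns.
  have aE : ent a j + f = ent a j * (1 ^+ 2 + f / ent a j) by rewrite expr1n; field.
  have det0 : ent a j + f != 0 by rewrite aE mulf_neq0.
  have [_ vaf] := ovD_lt hF aj (vge_vgt (vE 0 0) jr).
  rewrite dE detA; split => //.
    have -> : ent a j * (ent a j + f) = ent a j ^+ 2 * (1 ^+ 2 + f / ent a j).
      by rewrite aE; ring.
    by apply: (dgeM hF) => //; rewrite ?sqrf_eq0 //; exact: dge_sq.
  apply: (invmx_vge hF); rewrite ?dE //; last by rewrite vaf mul1r.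
  move=> i k; rewrite !ord1 !mxE eqxx mulr1n; apply: (vgeD hF); first exact: vge_ent.
  by apply: vgeW (vE 0 0) _; exact: ltW.
- move=> w vw; rewrite mul_mx_scalar -scalemxAl mxE.
  have -> : (w^T *m w) 0 0 = w 0 0 ^+ 2 by rewrite mxE big_ord1 mxE.
  have rs : r - (RR j + RR j) / 2 <= r - RR j by lras.
  have rs0 : 0 <= r - RR j by lras.
  have [h1 _ h2] := norm_gp_block hF a_neq0 hal pos hr rs0 rs (vw 0 0).
  rewrite mulrC; split => //.
  by apply: vgeW (vgeM hF (vgeX2 hF (vw 0 0)) (@vge_ent _ _ _ j)) _; lras.
Qed.

Section BinaryBlock.
Context (j : nat) (b c : F) (bin : binary_gram ord a j b c).
Context (pos : block_pos ord a j j.+1) (jm : (j.+1 <= m)%N) (br : ov b < r).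
Context (S_le : RR j + RR j.+1 <= RR m + RR m.+1).

Local Ltac lras ::= move: (al_gt0) (R_jump) (hr) (hn) (br) (S_le) => *; lra.

Local Notation aj := (ent a j).
Local Notation D := (b ^+ 2 - aj * c).

(** With the unit u = 1 + g/b, the quotient D'/D is u^2 plus a_j c (u^2 - 1)/D minus (a_j h + c f +
    f h)/D. [T1] to [T5] show that each of these corrections is a near square. *)
Lemma binary_perturb f g h : gm f -> gm h -> vge r g ->
  let D' := (b + g) ^+ 2 - (aj + f) * (c + h) in D' != 0 /\ dge (D * D') al.
Proof.
move=> [Gf vf] [Gh vh] vg D'.
case: (hal) => hm h0 h1 _; case: (pos) => hj _ js P1 P2.
case: (bin) => [[dE lt vc b0 vb] le].
have aj0 : aj != 0 by apply: a_neq0; nlia.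
have aj1 : ent a j.+1 != 0 by apply: a_neq0; nlia.
have DE : D = - aj * ent a j.+1 by rewrite mulNr dE; ring.
have D0 : D != 0 by rewrite DE mulf_neq0 ?oppr_eq0.
have vD : ov D = 2 * ov b.
  by rewrite DE (ovM hF) ?oppr_eq0 // (ovN hF) vb -!/(R ord a _); lras.
have Rm : RR j.+1 <= RR m by apply: P2; nlia.
have Rm1 : RR j.+1 <= RR m.+1 by apply: P2; nlia.
pose q := Num.max 0 (al - RR m.+1 + RR j).
have q0 : 0 <= q by rewrite le_max lexx.
have q1 : al <= RR m.+1 - RR j + q.
  suff : al - RR m.+1 + RR j <= q by lras.
  by rewrite le_max lexx orbT.
have dq : dge (- aj * ent a j.+1) q.
  rewrite /q; case: (lerP 0 _) => _; last exact: dge_le0.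
  by apply: dgeW (h1 j ltac:(nlia)) _; lras.
have hj' : (1 <= j < size a)%N by nlia.
have [k [w [w' [cE vk vw vw']]]] := binary_diag hF a_neq0 hj' bin q0 dq.
have vww : vge (RR j) (w + w').
  have -> : w + w' = c - aj * k ^+ 2 by rewrite cE; ring.
  apply: (vgeB hF) => //; apply: vgeW (vgeM hF (@vge_ent _ _ _ j) (vgeX2 hF vk)) _; lras.
have [y [t [yE vt]]] := dq; rewrite -DE in yE vt.
have vy := dge_root_order hF q0 yE vt; rewrite vD in vy vt.
(* Z^2/D = (Z/D)^2 D, and D = y^2 + t is itself a square up to t. *)
have sqD zz Z : vge zz Z -> ov b + tau <= zz -> al <= 2 * zz - 2 * ov b + q ->
    near_sq (Z ^+ 2 / D).
  move=> vZ z1 z2; exists (Z * y / D), (Z ^+ 2 * t / D ^+ 2); split.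
  - have -> : Z ^+ 2 / D = Z ^+ 2 * D / D ^+ 2 by field.
    by rewrite {1}yE; field.
  - by apply: vgeW (vge_div hF (vgeM hF vZ vy)) _; rewrite vD; lras.
  - apply: vgeW (vge_div hF (vgeM hF (vgeX2 hF vZ) vt)) _.
    by rewrite (ovX2 hF) // vD; lras.
have small zz x : vge zz x -> al + 2 * ov b <= zz -> near_sq (x / D).
  move=> vx hz; apply: near_sq_small; apply: vgeW (vge_div hF vx) _; rewrite vD; lras.
(* As D = -a_j a_(j+1), the quotient is -x / a_(j+1), and j+1 is the last index of the block. *)
have T1 x : G x -> near_sq (aj * x / D).
  move=> Gx; have -> : aj * x / D = - (x / ent a j.+1) by rewrite DE; field; rewrite oppr_eq0 aj0 aj1.
  by apply: near_sqN; exact: near_sq_quot pos jm Gx.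
have [X [f' [fE X0 X1 vf']]] := Gf; have [Y [h' [hE Y0 Y1 vh']]] := Gh.
have vamX : vge (RR m.+1) (ent a m * X ^+ 2).
  by apply: vgeW (vgeM hF (@vge_ent _ _ _ m) (vgeX2 hF X1)) _; lras.
(* Replacing c by a_j k^2 + w + w' reduces this term to [T1] and small terms. *)
have T2 : near_sq (c * f / D).
  have -> : c * f / D = k ^+ 2 * (aj * f / D) + w * (ent a m * X ^+ 2) / D
     + w' * (ent a m * X ^+ 2) / D + (w + w') * f' / D by rewrite cE fE; ring.
  apply: near_sqD; first apply: near_sqD; first apply: near_sqD.
  - by apply: near_sqZ => //; exact: T1.
  - by apply: small (vgeM hF vw vamX) _; lras.
  - by apply: small (vgeM hF vw' vamX) _; lras.
  - by apply: small (vgeM hF vww vf') _; lras.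
have T3 : near_sq (f * h / D).
  have -> : f * h / D = (ent a m * (X * Y)) ^+ 2 / D + f' * h / D
      + ent a m * X ^+ 2 * h' / D by rewrite fE hE; ring.
  apply: near_sqD; first apply: near_sqD.
  - by apply: (sqD _ _ (vgeM hF (@vge_ent _ _ _ m) (vgeM hF X1 Y1))); lras.
  - by apply: small (vgeM hF vf' vh) _; lras.
  - by apply: small (vgeM hF vamX vh') _; lras.
have T4 : near_sq (2%:R * (g * (aj * c) / b) / D).
  apply: small (vge_mul2 hF (vge_div hF (vgeM hF vg (vgeM hF (@vge_ent _ _ _ j) vc)))) _.
  lras.
have vgb := vge_div hF vg (y := b).
have T5 : near_sq ((g / b) ^+ 2 * (aj * c) / D).
  have -> : (g / b) ^+ 2 * (aj * c) / D = (g / b * (aj * k)) ^+ 2 / D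
     + (g / b) ^+ 2 * (aj * w) / D + (g / b) ^+ 2 * (aj * w') / D by rewrite cE; ring.
  apply: near_sqD; first apply: near_sqD.
  - by apply: (sqD _ _ (vgeM hF vgb (vgeM hF (@vge_ent _ _ _ j) vk))); lras.
  - by apply: small (vgeM hF (vgeX2 hF vgb) (vgeM hF (@vge_ent _ _ _ j) vw)) _; lras.
  - by apply: small (vgeM hF (vgeX2 hF vgb) (vgeM hF (@vge_ent _ _ _ j) vw')) _; lras.
have [bg0 vbg] := ovD_lt hF b0 (vge_vgt vg br).
have u0 : (b + g) / b != 0 by rewrite mulf_neq0 ?invr_eq0.
have vu : ov ((b + g) / b) = 0 by rewrite (ovM hF) ?invr_eq0 // (ovV hF) // vbg subrr.
have ns := near_sqD (near_sqD T4 T5) (near_sqN (near_sqD (near_sqD T2 (T1 h Gh)) T3)).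
have [nz dg] := near_sq_unit u0 vu ns; set x := _ + _ in nz dg.
have D'E : D' = D * x by rewrite /D' /x; field; rewrite D0 b0.
split; first by rewrite D'E mulf_neq0.
have -> : D * D' = D ^+ 2 * x by rewrite D'E; ring.
by apply: (dgeM hF); rewrite ?sqrf_eq0 //; exact: dge_sq.
Qed.

Lemma det_mx22 (A : 'M[F]_2) : \det A = A 0 0 * A 1 1 - A 0 1 * A 1 0.
Proof.
rewrite (expand_det_row _ 0) !big_ord_recl big_ord0 addr0 /cofactor !det_mx11 !mxE /=.
rewrite expr0 mul1r expr1 mulN1r mulrN.
by do ?[congr (_ * _)]; do ?[congr (_ - _)]; do ?[congr (_ * _)]; congr (A _ _); apply/val_inj.
Qed.

Lemma admissible_binary (A : 'M_2) :
  A 0 0 = aj -> A 0 1 = b -> A 1 0 = b -> A 1 1 = c -> admissible A.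
Proof.
move=> A00 A01 A10 A11.
case: (pos) => hj _ js P1 P2; case: (bin) => [[dE lt vc b0 vb] le].
have aj0 : aj != 0 by apply: a_neq0; nlia.
have aj1 : ent a j.+1 != 0 by apply: a_neq0; nlia.
have ord2 (P : 'I_2 -> Prop) : P 0 -> P 1 -> forall i, P i.
  by move=> p0 p1 [[|[|]] hi] //; [have -> : Ordinal hi = 0 | have -> : Ordinal hi = 1];
     rewrite //; exact: val_inj.
have symA : A^T = A.
  apply/matrixP => i l; rewrite mxE; move: i l.
  by apply: (ord2); apply: (ord2); rewrite ?A00 ?A01 ?A10 ?A11.
have detA : \det A = - D by rewrite det_mx22 A00 A01 A10 A11; ring.
have DE : D = - aj * ent a j.+1 by rewrite mulNr dE; ring.
have D0 : D != 0 by rewrite DE mulf_neq0 ?oppr_eq0.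
apply: (@admissible_intro _ _ (ov b)) => //; first by rewrite detA oppr_eq0.
- move=> E [sE vE gE].
  have E10 : E 1 0 = E 0 1 by rewrite -[in LHS]sE mxE.
  have [D'0 dg] := binary_perturb (gE 0) (gE 1) (vE 0 1).
  set D' := _ - _ in D'0 dg.
  have dAE : \det (A + E) = - D'.
    by rewrite det_mx22 !mxE A00 A01 A10 A11 E10 /D'; ring.
  rewrite detA dAE mulrNN oppr_eq0; split => //.
  have vAE : mxvge ord (ov b) (A + E).
    have vEb i l : vge (ov b) (E i l) by apply: vgeW (vE i l) _; exact: ltW.
    apply: (mxvgeD hF) => //; apply: (ord2); apply: (ord2); rewrite ?A00 ?A01 ?A10 ?A11 //.
    - by apply: vgeW (@vge_ent _ _ _ j) _; lras.
    - by apply: vgeW vc _; lras.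
  apply: (invmx_vge hF) => //; rewrite dAE ?oppr_eq0 // (ovN hF).
  have [bg0 vbg] := ovD_lt hF b0 (vge_vgt (vE 0 1) br).
  have bg20 : (b + E 0 1) ^+ 2 != 0 by rewrite sqrf_eq0.
  have s2 : vgt ord (ov ((b + E 0 1) ^+ 2)) (- ((aj + E 0 0) * (c + E 1 1))).
    rewrite (ovX2 hF) // vbg -mulNr.
    have -> : 2 * ov b = ov b + ov b by lras.
    apply: (vgtM hF).
      apply: (vgeN hF); apply: (vgeD hF).
        by apply: vgeW (@vge_ent _ _ _ j) _; lras.
      by apply: vgeW (vE 0 0) _; exact: ltW.
    apply: (vgtD hF); first by apply: vge_vgt vc _; lras.
    exact: vge_vgt (vE 1 1) br.
  by have [_ ->] := ovD_lt hF bg20 s2; rewrite (ovX2 hF) // vbg.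
- move=> w vw.
  have rs0 : 0 <= r - ov b by lras.
  have [h1 _ h2] := norm_gp_binary hF a_neq0 hal pos bin hr rs0 (lexx _) (vw 0 0) (vw 1 0).
  suff -> : (w^T *m A *m w) 0 0 = aj * w 0 0 ^+ 2 + 2%:R * b * w 0 0 * w 1 0 + c * w 1 0 ^+ 2.
    by [].
  rewrite mx11_congr !big_ord_recl !big_ord0.
  have -> : lift 0 0 = 1 :> 'I_2 by exact: val_inj.
  by rewrite A00 A01 A10 A11; ring.
Qed.

End BinaryBlock.

End Perturbation.

(** * Orthogonal splittings *)

Section Splittings.
Context {F : fieldType} (ord : F -> int) (hF : dyadic_local_field ord).
Context {V : vectType F} (B : {symmetric V}).

Local Notation vge := (vge ord).

Lemma bform_sym x y : B x y = B y x.
Proof. by rewrite hermC expr0 mul1r. Qed.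

Lemma bformDl x y z : B (x + y) z = B x z + B y z.
Proof. exact: linearDl. Qed.

Lemma bformDr x y z : B x (y + z) = B x y + B x z.
Proof. exact: linearDr. Qed.

Lemma bformZl c x y : B (c *: x) y = c * B x y.
Proof. exact: linearZl_LR. Qed.

Lemma bformZr c x y : B x (c *: y) = c * B x y.
Proof. exact: linearZr_LR. Qed.

Lemma bform0l x : B 0 x = 0. Proof. exact: linear0l. Qed.

Lemma bform0r x : B x 0 = 0. Proof. exact: linear0r. Qed.

Lemma bformBr x y z : B x (y - z) = B x y - B x z.
Proof. exact: linearBr. Qed.

Lemma bform_suml (I : Type) (s : seq I) (P : pred I) (f : I -> V) y :
  B (\sum_(i <- s | P i) f i) y = \sum_(i <- s | P i) B (f i) y.
Proof.
by elim/big_rec2: _ => [|i u v _ <-]; rewrite ?bform0l // bformDl.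
Qed.

Lemma bform_sumr (I : Type) (s : seq I) (P : pred I) (f : I -> V) x :
  B x (\sum_(i <- s | P i) f i) = \sum_(i <- s | P i) B x (f i).
Proof.
by elim/big_rec2: _ => [|i u v _ <-]; rewrite ?bform0r // bformDr.
Qed.

Definition gramf p (z : 'I_p -> V) : 'M[F]_p := \matrix_(i, j) B (z i) (z j).

Definition lin p (c : 'I_p -> F) (z : 'I_p -> V) : V := \sum_i c i *: z i.

Definition catf p q (z : 'I_p -> V) (y : 'I_q -> V) (i : 'I_(p + q)) : V :=
  match split i with inl k => z k | inr k => y k end.

Lemma catfl p q (z : 'I_p -> V) (y : 'I_q -> V) i : catf z y (lshift q i) = z i.
Proof. by rewrite /catf (unsplitK (inl _ i)). Qed.

Lemma catfr p q (z : 'I_p -> V) (y : 'I_q -> V) i : catf z y (rshift p i) = y i.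
Proof. by rewrite /catf (unsplitK (inr _ i)). Qed.

Lemma lin_catf p q (c : 'I_(p + q) -> F) (z : 'I_p -> V) (y : 'I_q -> V) :
  lin c (catf z y) = lin (c \o lshift q) z + lin (c \o @rshift p q) y.
Proof.
rewrite /lin big_split_ord /=; congr (_ + _); apply: eq_bigr => i _.
  by rewrite catfl.
by rewrite catfr.
Qed.

Lemma lin_catE p q (c : 'I_p -> F) (c' : 'I_q -> F) (z : 'I_p -> V) (y : 'I_q -> V) :
  exists2 k : 'I_(p + q) -> F, lin c z + lin c' y = lin k (catf z y) &
    (forall i, vge 0 (c i)) -> (forall i, vge 0 (c' i)) -> forall i, vge 0 (k i).
Proof.
exists (fun i => match split i with inl k => c k | inr k => c' k end).
  rewrite lin_catf; congr (_ + _); apply: eq_bigr => i _ /=.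
    by rewrite (unsplitK (inl _ i)).
  by rewrite (unsplitK (inr _ i)).
by move=> h h' i; case: split.
Qed.

Lemma gramf_catf p q (z : 'I_p -> V) (y : 'I_q -> V) :
  (forall i j, B (z i) (y j) = 0) ->
  gramf (catf z y) = block_mx (gramf z) 0 0 (gramf y).
Proof.
move=> h; apply/matrixP => i j.
case: (splitP i) => k ik; case: (splitP j) => l jl.
- have -> : i = lshift q k by exact: val_inj.
  have -> : j = lshift q l by exact: val_inj.
  by rewrite block_mxEul !mxE !catfl.
- have -> : i = lshift q k by exact: val_inj.
  have -> : j = rshift p l by exact: val_inj.
  by rewrite block_mxEur !mxE catfl catfr h.
- have -> : i = rshift p k by exact: val_inj.
  have -> : j = lshift q l by exact: val_inj.
  by rewrite block_mxEdl !mxE catfl catfr bform_sym h.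
- have -> : i = rshift p k by exact: val_inj.
  have -> : j = rshift p l by exact: val_inj.
  by rewrite block_mxEdr !mxE !catfr.
Qed.

Lemma gramf_lin p q (C : 'M_(p, q)) (y : 'I_q -> V) (t : 'I_p -> V) :
  (forall i j, B (t i) (y j) = 0) ->
  gramf (fun i => lin (C i) y + t i) = C *m gramf y *m C^T + gramf t.
Proof.
move=> h; apply/matrixP => i j; rewrite !mxE bformDl !bformDr.
have h0 k l : B (lin (C k) y) (t l) = 0.
  by rewrite bform_suml big1 // => n _; rewrite bformZl bform_sym h mulr0.
rewrite h0 [B (t i) _]bform_sym h0 addr0 add0r; congr (_ + _).
rewrite bform_sumr; apply: eq_bigr => k _.
rewrite bformZr mulrC mxE bform_suml; congr (_ * _); last by rewrite mxE.
by apply: eq_bigr => l _; rewrite bformZl mxE.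
Qed.

(* W is the inverse of the Gram matrix: every modular component of the lattice
   spanned by z has scale of order < r. *)
Definition scale_lt p (z : 'I_p -> V) (r : rat) : Prop :=
  exists2 W : 'M_p, W *m gramf z = 1%:M & forall i j, vgt ord (- r) (W i j).

Record splits (L : set V) p (z : 'I_p -> V) (N : set V) (r : rat) : Prop := {
  splits_mem : forall i, L (z i);
  splits_sub : forall n, N n -> L n;
  splits_dec : forall x, L x -> exists c n,
    [/\ forall i, vge 0 (c i), N n & x = lin c z + n];
  splits_orth : forall i n, N n -> B (z i) n = 0;
  splits_scale : forall n n', N n -> N n' -> vge r (B n n');
  splits_dual : scale_lt z r }.

Lemma splits_gram_neq0 L p (z : 'I_p -> V) N r : splits L z N r -> \det (gramf z) != 0.
Proof.
case=> _ _ _ _ _ [W WG _]; apply/eqP => G0.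
by have := congr1 determinant WG; rewrite det_mulmx G0 mulr0 det1 => /esym/eqP; rewrite oner_eq0.
Qed.

Lemma splits_coord L p (z : 'I_p -> V) N r q (y : 'I_q -> V) : splits L z N r ->
  (forall i, L (y i)) -> exists (C : 'M_(q, p)) (t : 'I_q -> V),
    [/\ mxvge ord 0 C, forall i, N (t i) & forall i, y i = lin (C i) z + t i].
Proof.
move=> [_ _ dec _ _ _] hy.
have /choice [f hf] : forall i, exists ct : ('I_p -> F) * V,
    [/\ forall k, vge 0 (ct.1 k), N ct.2 & y i = lin ct.1 z + ct.2].
  by move=> i; have [c [n h]] := dec _ (hy i); exists (c, n).
exists (\matrix_(i, k) (f i).1 k), (fun i => (f i).2); split => i.
- by move=> k; rewrite mxE; case: (hf i).
- by case: (hf i).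
- by case: (hf i) => _ _ ->; congr (_ + _); apply: eq_bigr => k _; rewrite mxE.
Qed.

Lemma gram_mixed p q (z : 'I_p -> V) (y : 'I_q -> V) (C : 'M_(p, q)) (t : 'I_p -> V) :
  (forall i j, B (t i) (y j) = 0) -> (forall i, z i = lin (C i) y + t i) ->
  \matrix_(i, j) B (z i) (y j) = C *m gramf y.
Proof.
move=> h zE; apply/matrixP => i j; rewrite !mxE zE bformDl h addr0 bform_suml.
by apply: eq_bigr => k _; rewrite bformZl mxE.
Qed.

(** Comparing Gram matrices gives (C C')^T = 1 - W G(t), where G(t) is the Gram matrix of the
    components of z in T. Its entries have order at least r and those of W order > -r, so C C' is
    congruent to 1 modulo p. *)
Lemma splits_unit L p q (z : 'I_p -> V) (y : 'I_q -> V) N T r C t C' n :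
  splits L z N r -> splits L y T r ->
  [/\ mxvge ord 0 C, forall i : 'I_p, T (t i) & forall i, z i = lin (C i) y + t i] ->
  [/\ mxvge ord 0 C', forall j : 'I_q, N (n j) & forall j, y j = lin (C' j) z + n j] ->
  \det (C *m C') != 0 /\ ov ord (\det (C *m C')) = 0.
Proof.
move=> [_ _ _ oN _ [W WG vW]] [_ _ _ oT sT _] [vC ht zE] [vC' hn yE].
have tO i j : B (t i) (y j) = 0 by rewrite bform_sym oT.
have nO j i : B (n j) (z i) = 0 by rewrite bform_sym oN.
have X1 := gram_mixed tO zE; have X2 := gram_mixed nO yE.
have GE : gramf z = C *m gramf y *m C^T + gramf t.
  rewrite -(gramf_lin _ tO); congr gramf; exact/funext.
have X3 : C *m gramf y = gramf z *m C'^T.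
  have symz : (gramf z)^T = gramf z by apply/matrixP => i j; rewrite !mxE bform_sym.
  rewrite -X1 -[gramf z]symz -trmx_mul -X2.
  by apply/matrixP => i j; rewrite !mxE bform_sym.
have E1 : (C *m C')^T = 1%:M + - (W *m gramf t).
  suff E0 : 1%:M = (C *m C')^T + W *m gramf t by rewrite E0 addrK.
  by rewrite trmx_mul -[LHS]WG {1}GE mulmxDr X3 !mulmxA WG mul1mx.
have small : vgt ord 0 (\det (C *m C') - 1).
  rewrite -det_tr E1; apply: (det_near1 hF) => i j; rewrite mxE -mulN1r -[0]add0r.
  apply: (vgtM hF); first by apply: (vgeN hF); exact: (vge1 hF).
  rewrite mxE; apply: (vgt_sum hF) => k _; rewrite mulrC -[0](subrr r).
  by apply: (vgtM hF) => //; rewrite mxE; apply: sT.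
have v1 : vgt ord (ov ord 1) (\det (C *m C') - 1) by rewrite (ov1 hF).
by have := ovD_lt hF (oner_neq0 F) v1; rewrite addrC subrK (ov1 hF).
Qed.

Lemma splits_size_le L p q (z : 'I_p -> V) (y : 'I_q -> V) N T r :
  splits L z N r -> splits L y T r -> (p <= q)%N.
Proof.
move=> sz sy; have [C [t h]] := splits_coord sy (splits_mem sz).
have [C' [n h']] := splits_coord sz (splits_mem sy).
have [det0 _] := splits_unit sz sy h h'.
have uC : C *m C' \in unitmx by rewrite unitmxE unitfE.
have := mxrankM_maxl C C'; rewrite mxrank_unit // => le.
exact: leq_trans le (rank_leq_col _).
Qed.

Lemma splits_size L p q (z : 'I_p -> V) (y : 'I_q -> V) N T r :
  splits L z N r -> splits L y T r -> p = q.
Proof.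
by move=> sz sy; apply/eqP; rewrite eqn_leq (splits_size_le sz sy) (splits_size_le sy sz).
Qed.

Lemma splits_gram L p (z y : 'I_p -> V) N T r :
  splits L z N r -> splits L y T r -> exists (C : 'M_p) (t : 'I_p -> V),
  [/\ mxvge ord 0 C, \det C != 0, ov ord (\det C) = 0, forall i, T (t i) &
      gramf z = C *m gramf y *m C^T + gramf t].
Proof.
move=> sz sy; have [C [t h]] := splits_coord sy (splits_mem sz).
have [C' [n h']] := splits_coord sz (splits_mem sy).
have [] := splits_unit sz sy h h'; rewrite det_mulmx mulf_eq0 negb_or => /andP[C0 C'0].
rewrite (ovM hF) // => v0.
case: h h' => vC ht zE [vC' _ _]; exists C, t; split => //.
- apply/eqP; rewrite eq_le; apply/andP; split; last first.
    by have := det_vge hF vC C0; rewrite mulr0.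
  by have := det_vge hF vC' C'0; rewrite mulr0; lra.
- rewrite -gramf_lin; first by congr gramf; exact/funext.
  by move=> i j; rewrite bform_sym (splits_orth sy).
Qed.

Definition obasis (M : set V) p (z : 'I_p -> V) : Prop :=
  forall x, M x <-> exists2 c, forall i, vge 0 (c i) & x = lin c z.

Lemma obasis_mem M p (z : 'I_p -> V) i : obasis M z -> M (z i).
Proof.
move=> h; apply/h; exists (fun j => (j == i)%:R).
  by move=> j; case: (j == i); [exact: (vge1 hF) | exact: vge0].
rewrite /lin (bigD1 i) //= eqxx scale1r big1 ?addr0 // => j /negPf->.
by rewrite scale0r.
Qed.

Definition spanf p (z : 'I_p -> V) : {vspace V} := <<[tuple z i | i < p]>>%VS.

Lemma mem_spanf p (z : 'I_p -> V) x : (x \in spanf z) <-> exists c, x = lin c z.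
Proof.
split => [/coord_span ->|[c ->]].
  exists (fun i => coord [tuple z i | i < p] i x); apply: eq_bigr => i _.
  by rewrite -tnth_nth tnth_mktuple.
apply: memv_suml => i _; apply: memvZ; apply: memv_span.
by apply/tnthP; exists i; rewrite tnth_mktuple.
Qed.

Lemma common_denominator p (c : 'I_p -> F) :
  exists2 k, k != 0 & forall i, vge 0 (c i / k).
Proof.
suff [N hN] : exists N : int, forall i, vge N%:~R (c i).
  have [k k0 vk] := ov_surj hF N.
  by exists k => // i; apply: vgeW (vge_div hF (hN i)) _; rewrite vk subrr.
elim: p c => [|p IH] c; first by exists 0 => -[].
have [N hN] := IH (c \o lift ord0).
exists (Num.min N (ord (c ord0))) => i.
case: (unliftP ord0 i) => [j ->|->].
  by apply: vgeW (hN j) _; rewrite ler_int ge_min lexx.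
by apply: vgeW (@vge_ov _ _ _) _; rewrite /ov ler_int ge_min lexx orbT.
Qed.

Lemma Fspace_obasis M p (z : 'I_p -> V) : obasis M z -> Fspace M = spanf z.
Proof.
move=> hM; have FE : [set x | x \in spanf z] = Fset M.
  apply/seteqP; split => x /=.
    move=> /mem_spanf[c ->]; have [k k0 hk] := common_denominator c.
    exists k, (lin (fun i => c i / k) z); split; first by apply/hM; exists (fun i => c i / k).
    rewrite /lin scaler_sumr; apply: eq_bigr => i _.
    by rewrite scalerA mulrC divfK.
  move=> [k [y [/hM[c _ ->] ->]]]; apply/mem_spanf; exists (fun i => k * c i).
  by rewrite /lin scaler_sumr; apply: eq_bigr => i _; rewrite scalerA.
rewrite /Fspace; case: (xgetP 0%VS [set W : {vspace V} | [set x | x \in W] = Fset M]).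
  move=> W _ /= WE; apply/vspaceP => x.
  have : [set x | x \in W] x <-> [set x | x \in spanf z] x by rewrite WE FE.
  by move=> /= h; apply/idP/idP => /h.
by move=> /(_ (spanf z)) /(_ FE).
Qed.

Lemma det_gram_size (s : seq V) p : size s = p ->
  \det (gram B s) = \det (gramf (fun i : 'I_p => s`_i)).
Proof. by case: p /. Qed.

(** [det_space] is computed in some F-basis of the space. A nonzero Gram determinant makes z
    independent, so the change of basis P is square and contributes the square of its
    determinant. *)
Lemma det_space_obasis M p (z : 'I_p -> V) : obasis M z -> \det (gramf z) != 0 ->
  rank M = p /\ exists2 c, c != 0 & det_space B M = \det (gramf z) * c ^+ 2.
Proof.
move=> hM G0; rewrite /rank /det_space (Fspace_obasis hM); set U := spanf z.
have zU i : z i \in U.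
  by have [c _ cE] := (hM (z i)).1 (obasis_mem i hM); apply/mem_spanf; exists c.
pose vb := vbasis U; pose y (i : 'I_(\dim U)) := vb`_i.
pose P : 'M_(p, \dim U) := \matrix_(i, j) coord vb j (z i).
have zE i : z i = lin (P i) y + 0.
  rewrite addr0 {1}(coord_vbasis (zU i)); apply: eq_bigr => j _; by rewrite mxE.
have GE : gramf z = P *m gramf y *m P^T.
  transitivity (gramf (fun i => lin (P i) y + 0)); first by congr gramf; exact/funext.
  rewrite (gramf_lin P (t := fun=> 0)) => [|i j]; last exact: bform0l.
  by apply/matrixP => i j; rewrite !mxE bform0l addr0.
have le1 : (\dim U <= p)%N.
  by rewrite -[X in (_ <= X)%N](size_tuple [tuple z i | i < p]) dim_span.
have le2 : (p <= \dim U)%N.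
  have uG : gramf z \in unitmx by rewrite unitmxE unitfE.
  rewrite -(mxrank_unit uG) GE -mulmxA; apply: leq_trans (mxrankM_maxl _ _) (rank_leq_col _).
have dU : \dim U = p by apply/eqP; rewrite eqn_leq le1.
split => //; rewrite (det_gram_size (p := \dim U)) ?size_tuple //.
rewrite -/vb -/y; clearbody y; clear zE; clearbody P; move: (\dim U) dU y P GE => q qp.
case: _ / (esym qp) => y P GE.
have := G0; rewrite GE !det_mulmx det_tr !mulf_eq0 !negb_or => /andP[/andP[P0 _] _].
exists (\det P)^-1; first by rewrite invr_eq0.
by field.
Qed.

Lemma scale_lt_catf p q (z : 'I_p -> V) (y : 'I_q -> V) r :
  (forall i j, B (z i) (y j) = 0) -> scale_lt z r -> scale_lt y r ->
  scale_lt (catf z y) r.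
Proof.
move=> h [W WG vW] [W' WG' vW']; exists (block_mx W 0 0 W').
  by rewrite gramf_catf // mulmx_block !mul0mx !mulmx0 !addr0 !add0r WG WG' -scalar_mx_block.
have v0 : vgt ord (- r) 0 by rewrite /vgt eqxx.
move=> i j; case: (splitP i) => k ik; case: (splitP j) => l jl.
- have -> : i = lshift q k by exact: val_inj.
  have -> : j = lshift q l by exact: val_inj.
  by rewrite block_mxEul.
- have -> : i = lshift q k by exact: val_inj.
  have -> : j = rshift p l by exact: val_inj.
  by rewrite block_mxEur mxE.
- have -> : i = rshift p k by exact: val_inj.
  have -> : j = lshift q l by exact: val_inj.
  by rewrite block_mxEdl mxE.
- have -> : i = rshift p k by exact: val_inj.
  have -> : j = rshift p l by exact: val_inj.
  by rewrite block_mxEdr.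
Qed.

Lemma scale_lt_det p (z : 'I_p -> V) s r : mxvge ord s (gramf z) -> \det (gramf z) != 0 ->
  ov ord (\det (gramf z)) = p%:R * s -> s < r -> scale_lt z r.
Proof.
move=> vG G0 vd sr; exists (invmx (gramf z)).
  by rewrite mulVmx // unitmxE unitfE.
have vI := invmx_vge hF vG G0 vd.
by move=> i j; apply: vge_vgt (vI i j) _; lra.
Qed.

Lemma scale_lt_nil (z : 'I_0 -> V) r : scale_lt z r.
Proof. by exists 1%:M => [|[]//]; apply/matrixP => -[]. Qed.

End Splittings.

(** * The splitting attached to a good BONG *)

Section Bongs.
Context {F : fieldType} (ord : F -> int) (hF : dyadic_local_field ord).
Context {V : vectType F} (B : {symmetric V}).
Context (a : seq F) (a_neq0 : forall j, (1 <= j <= size a)%N -> ent a j != 0).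
Context (good_a : good ord a).

Local Notation ov := (ov ord).
Local Notation vge := (vge ord).
Local Notation RR := (R ord a).
Local Notation ee := (e ord).
Local Notation Q := (Q B).

Lemma good_step l : (1 <= l)%N -> (l.+2 <= size a)%N -> RR l <= RR l.+2.
Proof. by move=> l1 ls; rewrite /R ler_int; apply: good_a. Qed.

Lemma good_mono l d : (1 <= l)%N -> (l + d.*2 <= size a)%N -> RR l <= RR (l + d.*2).
Proof.
move=> l1; elim: d => [|d IH]; first by rewrite addn0.
rewrite doubleS !addnS => ls; apply: le_trans (IH _) _; first by nlia.
by apply: good_step => //; nlia.
Qed.

Lemma good_sum_mono l k : (1 <= l <= k)%N -> (k < size a)%N ->
  RR l + RR l.+1 <= RR k + RR k.+1.
Proof.
move=> /andP[l1]; elim: k => [|k IH]; first by nlia.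
rewrite leq_eqVlt => /orP[/eqP->//|]; rewrite ltnS => lk ks.
have := IH lk (ltnW ks).
have := good_step (l := k) ltac:(nlia) ltac:(nlia); lra.
Qed.

(** The places where a cut between two blocks may fall: a drop R_m > R_(m+1) lies inside a binary
    block. *)
Definition boundary (m : nat) : Prop :=
  [\/ m = 0%N, m = size a | RR m <= RR m.+1].

Lemma parity_split l k : (l <= k)%N ->
  (exists d, k = (l + d.*2)%N) \/ (exists d, k = (l + d.*2).+1).
Proof.
move=> lk; have := odd_double_half (k - l); case: odd => h; [right|left];
  by exists (k - l)./2; nlia.
Qed.

(** Goodness compares indices of equal parity; the inequality at the cut links the two parities. *)
Lemma boundary_left m l : boundary m -> (m < size a)%N -> (1 <= l <= m.+1)%N ->
  RR l <= RR m.+1.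
Proof.
move=> bm ms hl.
have [[d dE]|[d [dE]]] := parity_split (l := l) (k := m.+1) ltac:(nlia).
- by rewrite dE; apply: good_mono; [nlia | rewrite -dE].
- case: bm => [m0|mn|le]; [nlia|nlia|]; apply: le_trans le.
  by rewrite dE; apply: good_mono; [nlia | rewrite -dE; nlia].
Qed.

Lemma boundary_right m l : boundary m -> (1 <= m)%N -> (m <= l <= size a)%N ->
  RR m <= RR l.
Proof.
move=> bm m1 hl.
have [[d dE]|[d dE]] := parity_split (l := m) (k := l) ltac:(nlia).
- by rewrite dE; apply: good_mono => //; rewrite -dE; nlia.
- case: bm => [m0|mn|le]; [nlia|nlia|]; apply: le_trans le _.
  by rewrite dE -addSn; apply: good_mono => //; rewrite addSn -dE; nlia.
Qed.

Lemma block_pos_unary m : boundary m -> boundary m.+1 -> (m < size a)%N ->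
  block_pos ord a m.+1 m.+1.
Proof.
move=> bm bm1 ms; split; try nlia; move=> l hl.
- exact: boundary_left.
- by apply: boundary_right.
Qed.

Lemma block_pos_binary m : boundary m -> boundary m.+2 -> (m.+1 < size a)%N ->
  RR m.+2 < RR m.+1 -> block_pos ord a m.+1 m.+2.
Proof.
move=> bm bm2 ms lt; split; try nlia; move=> l hl.
- have [->|ne] := eqVneq l m.+2; first exact: ltW.
  by apply: boundary_left => //; nlia.
- have [->|ne] := eqVneq l m.+1; first exact: ltW.
  by apply: boundary_right => //; nlia.
Qed.

(* [bong_split m T]: T is the orthogonal sum of rank one and binary modular
   lattices, carrying the entries of a of index greater than m. *)
Inductive bong_split : nat -> set V -> Prop :=
| bong_split_nil T : (forall v, T v <-> v = 0) -> bong_split (size a) T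
| bong_split_unary m x T T' :
    (m < size a)%N -> Q x = ent a m.+1 -> block_pos ord a m.+1 m.+1 ->
    (forall y, T' y -> B x y = 0) ->
    (forall v, T v <-> exists c t, [/\ vge 0 c, T' t & v = c *: x + t]) ->
    bong_split m.+1 T' -> bong_split m T
| bong_split_binary m x z T T' :
    (m.+1 < size a)%N -> Q x = ent a m.+1 ->
    binary_gram ord a m.+1 (B x z) (Q z) -> block_pos ord a m.+1 m.+2 ->
    (forall y, T' y -> B x y = 0 /\ B z y = 0) ->
    (forall v, T v <-> exists c d t,
       [/\ vge 0 c, vge 0 d, T' t & v = c *: x + d *: z + t]) ->
    bong_split m.+2 T' -> bong_split m T.

Lemma Q_add x y : Q (x + y) = Q x + Q y + 2%:R * B x y.
Proof. by rewrite /Defs.Q bformDl !bformDr [B y x]bform_sym; ring. Qed.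

Lemma Q_scale c x : Q (c *: x) = c ^+ 2 * Q x.
Proof. by rewrite /Defs.Q bformZl bformZr; ring. Qed.

Lemma proj_orthP x y : Q x != 0 -> B x (proj_orth B x y) = 0.
Proof. by move=> x0; rewrite bformBr bformZr -/(Q x) divfK // subrr. Qed.

Lemma proj_orth_dec x y : y = (B x y / Q x) *: x + proj_orth B x y.
Proof. by rewrite /proj_orth addrC subrK. Qed.

Lemma proj_orthB x u v : proj_orth B x (u - v) = proj_orth B x u - proj_orth B x v.
Proof.
rewrite /proj_orth bformBr mulrBl scalerBl !opprB [X in _ - _ + X]addrC addrACA.
by congr (_ + _); rewrite addrC.
Qed.

Lemma proj_orthZ x c u : proj_orth B x (c *: u) = c *: proj_orth B x u.
Proof. by rewrite /proj_orth bformZr scalerBr scalerA mulrA. Qed.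

Lemma Q_proj x y : Q x != 0 -> Q y = (B x y / Q x) ^+ 2 * Q x + Q (proj_orth B x y).
Proof.
move=> x0; rewrite {1}(proj_orth_dec x y) Q_add Q_scale bformZl proj_orthP //.
by rewrite !mulr0 addr0.
Qed.

Lemma Osub_scale (T : set V) c x : Osubmodule ord T -> vge 0 c -> T x -> T (c *: x).
Proof. by case=> _ _ TZ /O_vge/TZ; apply. Qed.

Lemma Osub_sub (T : set V) x y : Osubmodule ord T -> T x -> T y -> T (x - y).
Proof.
move=> sT hx hy; case: (sT) => _ TD _; apply: TD => //; rewrite -scaleN1r.
by apply: Osub_scale => //; apply: (vgeN hF); exact: (vge1 hF).
Qed.

Lemma Osub_proj (T : set V) x : Osubmodule ord T ->
  Osubmodule ord (proj_orth B x @` T).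
Proof.
case=> T0 TD TZ; split.
- by exists 0 => //; rewrite /proj_orth bform0r mul0r scale0r subr0.
- move=> _ _ [u hu <-] [v hv <-]; exists (u + v); first exact: TD.
  by rewrite /proj_orth bformDr mulrDl scalerDl opprD addrACA.
- move=> c _ hc [u hu <-]; exists (c *: u); first exact: TZ.
  exact: proj_orthZ.
Qed.

Lemma norm_mem (T : set V) x y : Q x != 0 -> norm ord B T = principal ord (Q x) ->
  T y -> vge (ov (Q x)) (Q y).
Proof.
move=> x0 nT Ty; apply/(principalP hF) => //; rewrite -nT.
by apply: sub_gen_smallest; exists y.
Qed.

(** The square of the coefficient is the difference of the values of y and of its projection,
    divided by Q x. *)
Lemma split_integral (T : set V) x : Q x != 0 ->
  (forall y, T y -> vge (ov (Q x)) (Q y)) ->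
  forall y, T y -> vge (ov (Q x)) (Q (proj_orth B x y)) -> vge 0 (B x y / Q x).
Proof.
move=> x0 hT y Ty hp; apply: (vge_sqrt hF).
have -> : (B x y / Q x) ^+ 2 = (Q y - Q (proj_orth B x y)) / Q x.
  by rewrite (Q_proj y x0) addrK mulfK.
by apply: vgeW (vge_div hF (vgeB hF (hT _ Ty) hp)) _; lra.
Qed.

Lemma split_unary (T : set V) x : Osubmodule ord T -> Q x != 0 -> T x ->
  (forall y, T y -> vge (ov (Q x)) (Q y)) ->
  (forall t, (proj_orth B x @` T) t -> vge (ov (Q x)) (Q t)) ->
  (forall t, (proj_orth B x @` T) t -> T t) /\
  forall v, T v <-> exists c t, [/\ vge 0 c, (proj_orth B x @` T) t & v = c *: x + t].
Proof.
move=> subT x0 Tx hT hp; case: (subT) => T0 TD TZ.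
have int y : T y -> vge 0 (B x y / Q x).
  by move=> Ty; apply: (split_integral x0 hT) => //; apply: hp; exists y.
have pT t : (proj_orth B x @` T) t -> T t.
  case=> y Ty <-; apply: Osub_sub => //; apply: Osub_scale => //; exact: int.
split => // v; split => [Tv|[c [t [hc ht ->]]]].
  exists (B x v / Q x), (proj_orth B x v); split; [exact: int | by exists v |].
  exact: proj_orth_dec.
apply: TD; last exact: pT.
exact: Osub_scale.
Qed.

(** The induction runs on a length bound, since a binary block consumes two vectors. If R_(m+1) <=
    R_(m+2), the values on the projection lie in the norm and x splits off; otherwise x splits off
    together with a preimage z of x2. *)
Lemma bong_splits n xs (T : set V) m : (size xs <= n)%N -> Osubmodule ord T ->
  is_bong ord B xs T -> [seq Q x | x <- xs] = drop m a -> (m <= size a)%N -> boundary m ->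
  bong_split m T.
Proof.
elim: n xs T m => [|n IH] [|x xs] T m; rewrite ?ltn0 // => le subT.
1,2: move=> /= -> /esym/eqP; rewrite -size_eq0 size_drop subn_eq0 => h1 h2 _;
  have -> : m = size a by apply/eqP; rewrite eqn_leq h1 h2.
1,2: by apply: bong_split_nil.
move=> /= [Tx x0 nT hb] xsE ms bm.
have m_lt : (m < size a)%N by rewrite -subn_gt0 -size_drop -xsE.
have dropE : drop m a = ent a m.+1 :: drop m.+1 a by rewrite (drop_nth 0).
move: xsE; rewrite dropE => -[Qx xsE].
have vQx : ov (Q x) = RR m.+1 by rewrite Qx.
have hT y : T y -> vge (RR m.+1) (Q y).
  by move=> Ty; rewrite -vQx; exact: norm_mem x0 nT Ty.
have subT' := Osub_proj x subT.
have nil_case ys (S : set V) rho : is_bong ord B ys S -> ys = [::] ->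
  forall t, S t -> vge rho (Q t).
  by move=> + ysE; rewrite ysE /= => -> t ->; rewrite /Defs.Q bform0l; exact: vge0.
have [xs0|xs_n0] := eqVneq (size xs) 0%N.
  have xsn : xs = [::] by apply/nilP; rewrite /nilp xs0.
  have m1E : m.+1 = size a.
    by have := congr1 size xsE; rewrite size_map xs0 size_drop; nlia.
  have hp t : (proj_orth B x @` T) t -> vge (ov (Q x)) (Q t) by exact: (nil_case _ _ _ hb xsn).
  have [pT TE] := split_unary subT x0 Tx ltac:(by rewrite vQx) hp.
  have bm1 : boundary m.+1 by rewrite m1E; constructor 2.
  apply: (@bong_split_unary _ x _ (proj_orth B x @` T)) => //.
  - exact: block_pos_unary.
  - by move=> _ [y _ <-]; exact: proj_orthP.
  - by apply: (IH xs) => //; rewrite xsE.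
case: xs le hb xsE xs_n0 {nil_case} (nil_case) => // x2 xs le hb xsE _ nil_case.
have m2s : (m.+1 < size a)%N by rewrite -subn_gt0 -size_drop -xsE.
move: (hb) => /= [T'x2 x20 nT' hb'].
have dropE' : drop m.+1 a = ent a m.+2 :: drop m.+2 a by rewrite (drop_nth 0).
move: (xsE); rewrite /= dropE' => -[Qx2 xsE'].
have vQx2 : ov (Q x2) = RR m.+2 by rewrite Qx2.
have hT' y : (proj_orth B x @` T) y -> vge (RR m.+2) (Q y).
  by move=> Ty; rewrite -vQx2; exact: norm_mem x20 nT' Ty.
have [leR|ltR] := lerP (RR m.+1) (RR m.+2).
  have hp t : (proj_orth B x @` T) t -> vge (ov (Q x)) (Q t).
    by move=> /hT' h; apply: vgeW h _; rewrite vQx.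
  have [pT TE] := split_unary subT x0 Tx ltac:(by rewrite vQx) hp.
  have bm1 : boundary m.+1 by constructor 3.
  apply: (@bong_split_unary _ x _ (proj_orth B x @` T)) => //.
  - exact: block_pos_unary.
  - by move=> _ [y _ <-]; exact: proj_orthP.
  - by apply: (IH (x2 :: xs)) => //.
(* Goodness enters here: R_(m+3) >= R_(m+1) brings the values on the second projection back into the
   norm of T. *)
have hT'' t : (proj_orth B x2 @` (proj_orth B x @` T)) t -> vge (RR m.+1) (Q t).
  case: xs hb' xsE' {le hb xsE} => [|x3 xs] hb' xsE'.
    by exact: (nil_case _ _ _ hb').
  move: hb' => /= [T''x3 x30 nT'' _] Tt.
  have m3s : (m.+2 < size a)%N by rewrite -subn_gt0 -size_drop -xsE'.
  have Qx3 : Q x3 = ent a m.+3 by move: xsE'; rewrite (drop_nth 0) // => -[].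
  have h := norm_mem x30 nT'' Tt; rewrite Qx3 in h.
  by apply: vgeW h _; apply: good_step.
have bm2 : boundary m.+2.
  have [->|ne] := eqVneq m.+2 (size a); first by constructor 2.
  constructor 3; apply: ltW; apply: lt_le_trans ltR _.
  by apply: good_step => //; nlia.
have subT'' := Osub_proj x2 subT'.
have hp2 t : (proj_orth B x2 @` (proj_orth B x @` T)) t -> vge (ov (Q x2)) (Q t).
  by move=> /hT'' h; apply: vgeW h _; rewrite vQx2; exact: ltW.
have [pT' T'E] := split_unary subT' x20 T'x2 ltac:(by rewrite vQx2) hp2.
case: (T'x2) => z Tz zE.
set b := B x z.
have zdec : z = (b / Q x) *: x + x2 by rewrite -zE; exact: proj_orth_dec.
have Bxx2 : B x x2 = 0 by rewrite -zE; exact: proj_orthP.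
have Qz : Q z = b ^+ 2 / Q x + Q x2.
  by rewrite (Q_proj z x0) zE -/b; congr (_ + _); field.
(* Q z lies in the norm, so its order exceeds that of Q x2; hence b^2 / Q x has the order of Q x2,
   which determines the order of b. *)
have sq0 : Q x2 != 0 /\ vgt ord (ov (Q x2)) (- Q z).
  by split => //; apply: vge_vgt (vgeN hF (hT _ Tz)) _; rewrite vQx2.
have [b20 vb2] := ovD_lt hF sq0.1 sq0.2.
have b2E : Q x2 - Q z = - (b ^+ 2 / Q x) by rewrite Qz; ring.
have b0 : b != 0.
  by apply: contraNneq b20 => b0; rewrite b2E b0 expr0n mul0r oppr0.
have vb : ov b = (RR m.+1 + RR m.+2) / 2.
  move: vb2; rewrite b2E (ovN hF) (ovM hF) ?invr_eq0 ?sqrf_eq0 // (ovV hF) // (ovX2 hF) //.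
  by rewrite vQx vQx2; lra.
have leb : RR m.+1 <= ee + ov b.
  have v2 : vge (RR m.+1) (2%:R * b).
    have -> : 2%:R * b = Q (x + z) - Q x - Q z by rewrite Q_add /b; ring.
    apply: (vgeB hF); last exact: hT.
    apply: (vgeB hF); last exact: hT.
    by apply: hT; case: subT => _ TD _; exact: TD.
  have := v2 (mulf_neq0 (two_neq0 hF) b0).
  by rewrite (ovM hF) ?(two_neq0 hF).
have bin : binary_gram ord a m.+1 b (Q z).
  split => //; split => //; last exact: hT.
  by rewrite -Qx -Qx2 Qz; field.
have orth t : (proj_orth B x2 @` (proj_orth B x @` T)) t -> B x t = 0 /\ B z t = 0.
  move=> Tt; have Bx : B x t = 0.
    by case: (pT' _ Tt) => y _ <-; exact: proj_orthP.
  split => //; rewrite zdec bformDl bformZl Bx mulr0 add0r.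
  by case: Tt => y _ <-; exact: proj_orthP.
(* Subtracting d z leaves a vector of T whose projection lies in the second projection, so its
   coefficient along x is integral. *)
have dec v d t : T v -> vge 0 d -> (proj_orth B x2 @` (proj_orth B x @` T)) t ->
    proj_orth B x v = d *: x2 + t ->
    exists2 c, vge 0 c & v = c *: x + d *: z + t.
  move=> Tv hd Tt vE.
  have Tw : T (v - d *: z).
    by apply: Osub_sub => //; apply: Osub_scale.
  have pw : proj_orth B x (v - d *: z) = t.
    by rewrite proj_orthB proj_orthZ zE vE addrAC subrr add0r.
  exists (B x (v - d *: z) / Q x).
    apply: (split_integral x0 (T := T)) => //; first by rewrite vQx.
    by rewrite pw vQx; exact: hT''.
  have := proj_orth_dec x (v - d *: z); rewrite pw => h.
  by rewrite addrAC -h subrK.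
apply: (@bong_split_binary _ x z _ (proj_orth B x2 @` (proj_orth B x @` T))) => //.
- exact: block_pos_binary.
- move=> v; split => [Tv|[c [d [t [hc hd Tt ->]]]]].
    have Tpv : (proj_orth B x @` T) (proj_orth B x v) by exists v.
    have [d [t [hd Tt vE]]] := (T'E _).1 Tpv.
    by have [c hc ->] := dec _ _ _ Tv hd Tt vE; exists c, d, t.
  case: (subT) => T0 TD TZ.
  apply: (TD); last first.
    have [y Ty yE] := pT' _ Tt.
    have h0 : vge 0 (0 : F) by exact: vge0.
    have [c' hc' yd] := dec y 0 t Ty h0 Tt ltac:(by rewrite yE scale0r add0r).
    have -> : t = y - c' *: x by rewrite yd scale0r addr0 addrC addKr.
    by apply: Osub_sub => //; apply: Osub_scale.
  by apply: (TD); apply: Osub_scale.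
- by apply: (IH xs) => //; apply: ltnW.
Qed.

End Bongs.

(** * Values and truncation of the BONG splitting *)

Section BongBlocks.
Context {F : fieldType} (ord : F -> int) (hF : dyadic_local_field ord).
Context {V : vectType F} (B : {symmetric V}).
Context (a : seq F) (a_neq0 : forall j, (1 <= j <= size a)%N -> ent a j != 0).
Context (good_a : good ord a).

Local Notation ov := (ov ord).
Local Notation vge := (vge ord).
Local Notation RR := (R ord a).
Local Notation ee := (e ord).
Local Notation Q := (Q B).
Local Notation bong_split := (bong_split ord B a).

Lemma vge_max p q x : vge p x -> vge q x -> vge (Num.max p q) x.
Proof. by move=> h1 h2 x0; rewrite ge_max h1 ?h2. Qed.

Lemma bong_split0 m T : bong_split m T -> T 0.
Proof.
elim=> {m T} [T TE|m x T T' _ _ _ _ TE _ T0|m x z T T' _ _ _ _ _ TE _ T0].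
- exact/TE.
- by apply/TE; exists 0, 0; rewrite scale0r addr0; split => //; exact: vge0.
- by apply/TE; exists 0, 0, 0; rewrite !scale0r !addr0; split => //; exact: vge0.
Qed.

Lemma norm_gp_bong m T i al r : bong_split m T -> alpha_level ord a i al ->
  (RR i + RR i.+1) / 2 <= r -> forall v, T v -> (forall w, T w -> vge r (B v w)) ->
  [/\ norm_gp ord a i al (Q v), vge (RR i) (Q v) & vge (RR i.+1) (Q v)].
Proof.
move=> bT hal hr; elim: bT => {m T}
  [T TE v /TE -> _|m x T T' ms Qx pos orth TE bT' IH v|m x z T T' ms Qx bin pos orth TE bT' IH v].
- by rewrite /Defs.Q bform0l; split; [exact: norm_gp0 | exact: vge0 | exact: vge0].
- move=> /TE[c [t [hc Tt ->]]] hv.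
  have x0 : Q x != 0 by rewrite Qx a_neq0 //; nlia.
  have Tx : T x.
    apply/TE; exists 1, 0; rewrite scale1r addr0; split => //; first exact: (vge1 hF).
    exact: bong_split0 bT'.
  have vc : vge (r - RR m.+1) c.
    have -> : c = B (c *: x + t) x / Q x.
      by rewrite bformDl bformZl [B t x]bform_sym (orth _ Tt) addr0 mulfK.
    by apply: vgeW (vge_div hF (hv _ Tx)) _; rewrite Qx.
  have TT' y : T' y -> T y.
    by move=> hy; apply/TE; exists 0, y; rewrite scale0r add0r; split => //; exact: vge0.
  have [G1 t1 t2] : [/\ norm_gp ord a i al (Q t), vge (RR i) (Q t) & vge (RR i.+1) (Q t)].
    apply: IH => // w Tw; have := hv _ (TT' _ Tw).
    by rewrite bformDl bformZl (orth _ Tw) mulr0 add0r.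
  have QE : Q (c *: x + t) = c ^+ 2 * ent a m.+1 + Q t.
    by rewrite Q_add Q_scale bformZl (orth _ Tt) !mulr0 addr0 Qx.
  pose lam := Num.max 0 (r - RR m.+1).
  have l0 : 0 <= lam by rewrite le_max lexx.
  have l1 : r - (RR m.+1 + RR m.+1) / 2 <= lam.
    by apply: le_trans (_ : r - RR m.+1 <= _); [lra | rewrite le_max lexx orbT].
  have vl : vge lam c by apply: vge_max.
  have [G2 s1 s2] := norm_gp_block hF a_neq0 hal pos hr l0 l1 vl.
  have vx : vge (RR m.+1 + 2 * lam) (c ^+ 2 * ent a m.+1).
    by apply: vgeW (vgeM hF (vgeX2 hF vl) (@vge_ent _ _ _ m.+1)) _; lra.
  rewrite QE; split; first exact: (norm_gpD hF hal).
  + by apply: (vgeD hF) => //; apply: vgeW vx _.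
  + by apply: (vgeD hF) => //; apply: vgeW vx _.
- move=> /TE[c [d [t [hc hd Tt vE]]]] hv.
  have T'0 := bong_split0 bT'.
  have h0 : vge 0 (0 : F) by exact: vge0.
  have h1 := vge1 hF.
  have Tx : T x by apply/TE; exists 1, 0, 0; rewrite scale1r scale0r !addr0.
  have Tz : T z by apply/TE; exists 0, 1, 0; rewrite scale1r scale0r add0r addr0.
  have TT' y : T' y -> T y by move=> hy; apply/TE; exists 0, 0, y; rewrite !scale0r !add0r.
  have Bxt : B x t = 0 by case: (orth _ Tt).
  have Bzt : B z t = 0 by case: (orth _ Tt).
  have vx := hv _ Tx; have vz := hv _ Tz.
  have Bvx : B v x = c * Q x + d * B x z.
    rewrite vE !bformDl !bformZl [B t x]bform_sym Bxt addr0.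
    by rewrite [B z x]bform_sym.
  have Bvz : B v z = c * B x z + d * Q z.
    by rewrite vE !bformDl !bformZl [B t z]bform_sym Bzt addr0.
  case: (bin) => [[dE lt vQz b0 vb] le].
  have a1 : ent a m.+1 != 0 by apply: a_neq0; nlia.
  have a2 : ent a m.+2 != 0 by apply: a_neq0; nlia.
  have D0 : ent a m.+1 * ent a m.+2 != 0 by rewrite mulf_neq0.
  have vD : ov (ent a m.+1 * ent a m.+2) = 2 * ov (B x z).
    by rewrite (ovM hF) // vb -!/(R _ _ _); lra.
  have vQx : vge (RR m.+1) (Q x) by rewrite Qx; exact: vge_ent.
  have vc : vge (r - ov (B x z)) c.
    have -> : c = (B v x * Q z - B v z * B x z) / (ent a m.+1 * ent a m.+2).
      by apply: (mulIf D0); rewrite divfK // dE -Qx Bvx Bvz; ring.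
    apply: vgeW (vge_div hF (q := r + ov (B x z)) _) _; last by rewrite vD; lra.
    apply: (vgeB hF); last exact: (vgeM hF).
    by apply: vgeW (vgeM hF vx vQz) _; lra.
  have vd : vge (r - ov (B x z)) d.
    have -> : d = (B v z * Q x - B v x * B x z) / (ent a m.+1 * ent a m.+2).
      by apply: (mulIf D0); rewrite divfK // dE -Qx Bvx Bvz; ring.
    apply: vgeW (vge_div hF (q := r + ov (B x z)) _) _; last by rewrite vD; lra.
    apply: (vgeB hF); last exact: (vgeM hF).
    by apply: vgeW (vgeM hF vz vQx) _; lra.
  have [G1 t1 t2] : [/\ norm_gp ord a i al (Q t), vge (RR i) (Q t) & vge (RR i.+1) (Q t)].
    apply: IH => // w Tw; have := hv _ (TT' _ Tw); case: (orth _ Tw) => Bxw Bzw.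
    by rewrite vE !bformDl !bformZl Bxw Bzw !mulr0 !add0r.
  pose lam := Num.max 0 (r - ov (B x z)).
  have l0 : 0 <= lam by rewrite le_max lexx.
  have l1 : r - ov (B x z) <= lam by rewrite le_max lexx orbT.
  have [] := norm_gp_binary hF a_neq0 hal pos bin hr l0 l1 (vge_max hc vc) (vge_max hd vd).
  set q := _ + _ => G2 s1 s2.
  have QE : Q v = q + Q t.
    have o : B (c *: x + d *: z) t = 0 by rewrite bformDl !bformZl Bxt Bzt !mulr0 addr0.
    rewrite vE Q_add o mulr0 addr0.
    by rewrite Q_add !Q_scale bformZl bformZr Qx /q; ring.
  rewrite QE; split; first exact: (norm_gpD hF hal).
  + exact: (vgeD hF).
  + exact: (vgeD hF).
Qed.

Lemma bong_scale m T rho : bong_split m T -> ((m < size a)%N -> rho <= RR m.+1) ->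
  ((m.+1 < size a)%N -> 2 * rho <= RR m.+1 + RR m.+2) ->
  forall v w, T v -> T w -> vge rho (B v w).
Proof.
elim=> {m T}
  [T TE _ _ v w /TE -> _|m x T T' ms Qx pos orth TE bT' IH h1 h2 v w|
   m x z T T' ms Qx bin pos orth TE bT' IH h1 h2 v w].
- by rewrite bform0l; exact: vge0.
- move=> /TE[c [t [hc Tt ->]]] /TE[c' [t' [hc' Tt' ->]]].
  rewrite !bformDl !bformDr !bformZl !bformZr (orth _ Tt') [B t x]bform_sym (orth _ Tt) !mulr0 addr0 add0r.
  have le := h1 ms; case: (pos) => _ _ _ P1 P2.
  apply: (vgeD hF).
    rewrite -/(Q x) Qx mulrA; apply: vgeW (vgeM hF (vgeM hF hc hc') (@vge_ent _ _ _ m.+1)) _; lra.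
  apply: IH => // ms'.
    by have := P2 m.+2 ltac:(nlia); lra.
  by have := P2 m.+2 ltac:(nlia); have := P2 m.+3 ltac:(nlia); lra.
- move=> /TE[c [d [t [hc hd Tt ->]]]] /TE[c' [d' [t' [hc' hd' Tt' ->]]]].
  have [Bxt Bzt] := orth _ Tt; have [Bxt' Bzt'] := orth _ Tt'.
  rewrite !bformDl !bformDr !bformZl !bformZr Bxt' Bzt' [B t x]bform_sym [B t z]bform_sym.
  rewrite Bxt Bzt [B z x]bform_sym !mulr0 !addr0 !add0r.
  case: (bin) => [[dE lt vQz b0 vb] le].
  have lem := h2 ms.
  have vc x1 x2 y : vge 0 x1 -> vge 0 x2 -> vge rho y -> vge rho (x1 * (x2 * y)).
    by move=> v1 v2 vy; apply: vgeW (vgeM hF v1 (vgeM hF v2 vy)) _; lra.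
  have vxx : vge rho (B x x).
    by rewrite -/(Q x) Qx; apply: vgeW (@vge_ent _ _ _ m.+1) _; lra.
  have vxz : vge rho (B x z) by apply: vgeW (@vge_ov _ _ _) _; rewrite vb; lra.
  have vzz : vge rho (B z z) by apply: vgeW vQz _; lra.
  have ih : vge rho (B t t').
    apply: IH => // ms'.
      by have := good_step good_a (l := m.+1) ltac:(nlia) ltac:(nlia); lra.
    have := good_step good_a (l := m.+1) ltac:(nlia) ltac:(nlia).
    by have := good_step good_a (l := m.+2) ltac:(nlia) ltac:(nlia); lra.
  do 2 ?apply: (vgeD hF) => //; apply: (vgeD hF); exact: vc.
Qed.

Lemma gramf1 x : gramf B (fun _ : 'I_1 => x) = (Q x)%:M.
Proof. by apply/matrixP => i j; rewrite !mxE !ord1 eqxx mulr1n. Qed.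

Definition pairf (x z : V) (i : 'I_2) : V := if i == 0 then x else z.

Lemma lin_pairf c x z : lin c (pairf x z) = c 0 *: x + c 1 *: z.
Proof. by rewrite /lin !big_ord_recl big_ord0 addr0; congr (_ + _ *: _); congr c; exact: val_inj. Qed.

Lemma pairf_all (P : V -> Prop) x z : P x -> P z -> forall i, P (pairf x z i).
Proof. by move=> hx hz i; rewrite /pairf; case: (i == 0). Qed.

Lemma splits_catf (T0 T1 N : set V) p q (z : 'I_p -> V) (y : 'I_q -> V) r :
  (forall v, T0 v <-> exists c t, [/\ forall i, vge 0 (c i), T1 t & v = lin c z + t]) ->
  (forall i t, T1 t -> B (z i) t = 0) -> T1 0 ->
  scale_lt ord B z r -> splits ord B T1 y N r -> splits ord B T0 (catf z y) N r.
Proof.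
move=> TE orth T10 sz [mem sub dec oN sN sy].
have T1T0 t : T1 t -> T0 t.
  move=> ht; apply/TE; exists (fun=> 0), t; split => //; first by move=> _; exact: vge0.
  by rewrite /lin big1 ?add0r // => i _; rewrite scale0r.
have zT0 i : T0 (z i).
  apply/TE; exists (fun j => (j == i)%:R), 0; split => //.
    by move=> j; case: (j == i); [exact: (vge1 hF) | exact: vge0].
  by rewrite addr0 /lin (bigD1 i) //= eqxx scale1r big1 ?addr0 // => j /negPf->; rewrite scale0r.
split => //.
- by move=> i; rewrite /catf; case: split => k //; apply: T1T0.
- by move=> n /sub; exact: T1T0.
- move=> x /TE[c [t [hc /dec[c' [n [hc' hn ->]]] ->]]].
  have [k kE hk] := lin_catE ord c c' z y.
  by exists k, n; split => //; [exact: hk | rewrite addrA kE].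
- by move=> i n hn; rewrite /catf; case: split => k; [apply: orth; exact: sub | exact: oN].
- by apply: scale_lt_catf => // i j; apply: orth.
Qed.

Lemma splits_self (T : set V) (z : 'I_0 -> V) r : T 0 ->
  (forall v w, T v -> T w -> vge r (B v w)) -> splits ord B T z T r.
Proof.
move=> T0 h; split => //; try by case.
- move=> x Tx; exists (fun=> 0), x; split => //; first by case.
  by rewrite /lin big_ord0 add0r.
- exact: scale_lt_nil.
Qed.

(* Cutting a good BONG at the scale r: the first m entries carry the blocks of
   scale order < r, the tail those of scale order >= r. *)
Record threshold (m0 : nat) (T0 : set V) (r : rat) (q : nat) (y : 'I_q -> V)
    (T : set V) : Prop := {
  thr_splits : splits ord B T0 y T r;
  thr_tail : bong_split (m0 + q) T;
  thr_det : \det (gramf B y) = \prod_(m0.+1 <= l < (m0 + q).+1) ent a l;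
  thr_next : (m0 + q < size a)%N -> r <= RR (m0 + q).+1;
  thr_first : (m0 + q < size a)%N -> exists2 x, T x & Q x = ent a (m0 + q).+1;
  thr_next_sum : (m0 + q < (size a).-1)%N ->
    2 * r <= RR (m0 + q).+1 + RR (m0 + q).+2 /\ RR (m0 + q).+1 <= RR (m0 + q).+2 + 2 * ee;
  thr_last : (0 < q)%N -> RR (m0 + q) < r;
  thr_last_sum : (1 < q)%N -> RR (m0 + q).-1 + RR (m0 + q) < 2 * r;
  thr_stable : forall al, alpha_level ord a (m0 + q) al -> 0 < al ->
    RR (m0 + q) < RR (m0 + q).+1 -> (RR (m0 + q) + RR (m0 + q).+1) / 2 <= r ->
    RR (m0 + q).+1 <= ee + r -> stable_det ord a (m0 + q) al r (gramf B y) }.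

Lemma bong_split_le m T : bong_split m T -> (m <= size a)%N.
Proof. by case=> // *; nlia. Qed.

(** Blocks move into y while their scale order is < r. The first block of larger scale stops the
    process, because everything after it has scale at least as large. *)
Lemma bong_threshold m0 T0 r : bong_split m0 T0 ->
  exists q (y : 'I_q -> V) T, threshold m0 T0 r y T.
Proof.
have stop m T : bong_split m T -> ((m < size a)%N -> r <= RR m.+1) ->
    ((m.+1 < size a)%N -> 2 * r <= RR m.+1 + RR m.+2 /\ RR m.+1 <= RR m.+2 + 2 * ee) ->
    ((m < size a)%N -> exists2 x, T x & Q x = ent a m.+1) ->
    exists q (y : 'I_q -> V) T', threshold m T r y T'.
  move=> bT h1 h2 h3; exists 0%N, (fun=> 0), T; split; rewrite ?addn0 //.
  - apply: splits_self; first exact: bong_split0 bT.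
    by apply: bong_scale bT _ _ => // ms; have [] := h2 ms.
  - by rewrite det_mx00 big_geq.
  - by move=> ms; apply: h2; nlia.
  - move=> al _ _ _ _ _; rewrite /stable_det det_mx00 oner_neq0; split => // E _.
    by rewrite det_mx00 oner_neq0 mulr1 -(expr1n _ 2); split => //; exact: dge_sq.
elim=> {m0 T0} [T TE|m x T T' ms Qx pos orth TE bT' IH|m x z T T' ms Qx bin pos orth TE bT' IH].
- by apply: stop; [exact: bong_split_nil | nlia | nlia | nlia].
- have bT : bong_split m T by exact: bong_split_unary TE bT'.
  have T'0 := bong_split0 bT'.
  have [le|lt] := lerP r (RR m.+1).
    case: (pos) => _ _ _ _ P2; apply: stop => // ms'.
      have := P2 m.+2 ltac:(nlia); have := ov2_gt0 hF; lra.
    exists x => //; apply/TE; exists 1, 0; rewrite scale1r addr0; split => //.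
    exact: (vge1 hF).
  have [q [y [N [sp tl dt nx fx ns ls lss st]]]] := IH.
  have mE : (m + (1 + q) = m.+1 + q)%N by nlia.
  have oy i j : B ((fun _ : 'I_1 => x) i) (y j) = 0 by apply: orth; exact: splits_mem sp j.
  exists (1 + q)%N, (catf (fun _ : 'I_1 => x) y), N; split; rewrite ?mE //.
  + apply: (splits_catf _ _ T'0 _ sp).
    * move=> v; split => [/TE[c [t [hc Tt ->]]]|[c [t [hc Tt ->]]]].
        by exists (fun=> c), t; split => //; rewrite /lin big_ord1.
      by apply/TE; exists (c 0), t; split => //; rewrite /lin big_ord1.
    * by move=> i t Tt; apply: orth.
    * apply: (scale_lt_det hF (s := RR m.+1)); rewrite ?gramf1 ?det_scalar1 ?Qx ?mul1r //.
        by move=> i j; rewrite !ord1 mxE eqxx mulr1n; exact: vge_ent.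
      by apply: a_neq0; nlia.
  + rewrite gramf_catf // det_ublock gramf1 det_scalar1 Qx dt [RHS]big_nat_recl; last by nlia.
    by rewrite [in LHS]big_add1.
  + have [->|q0] := posnP q; first by move=> _; rewrite addn0.
    by move=> _; exact: ls.
  + case: (ltnP 1 q) => q1 q2; first exact: lss.
    have [q0|q0] := posnP q; first by exfalso; nlia.
    have q1' : q = 1%N by nlia.
    by move: (ls q0); rewrite q1' addn1 /=; lra.
  + move=> al hal al0 jump hr hn; rewrite gramf_catf // gramf1 Qx.
    apply: (stable_det_block hF hal) => //; last exact: st.
    by apply: (admissible_unary hF a_neq0 hal al0 jump hr hn pos) => //; nlia.
- have bT : bong_split m T by exact: bong_split_binary TE bT'.
  have T'0 := bong_split0 bT'.
  have h0 : vge 0 (0 : F) by exact: vge0.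
  have h1 := vge1 hF.
  have Tx : T x by apply/TE; exists 1, 0, 0; rewrite scale1r scale0r !addr0.
  case: (bin) => [[dE ltR vQz b0 vb] leb].
  have [le|lt] := lerP (2 * r) (RR m.+1 + RR m.+2).
    by apply: stop => // [_|_|_]; [lra | split; lra | exists x].
  have [q [y [N [sp tl dt nx fx ns ls lss st]]]] := IH.
  have mE : (m + (2 + q) = m.+2 + q)%N by nlia.
  have oy i j : B (pairf x z i) (y j) = 0.
    have [o1 o2] := orth _ (splits_mem sp j).
    exact: (pairf_all (P := fun v => B v (y j) = 0)).
  have [g00 g01 g10 g11] : [/\ gramf B (pairf x z) 0 0 = ent a m.+1,
      gramf B (pairf x z) 0 1 = B x z, gramf B (pairf x z) 1 0 = B x z &
      gramf B (pairf x z) 1 1 = Q z].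
    by rewrite !mxE /pairf /= -/(Q x) Qx; split => //; exact: bform_sym.
  have detP : \det (gramf B (pairf x z)) = ent a m.+1 * ent a m.+2.
    by rewrite det_mx22 g00 g01 g10 g11 dE; ring.
  have a1 : ent a m.+1 != 0 by apply: a_neq0; nlia.
  have a2 : ent a m.+2 != 0 by apply: a_neq0; nlia.
  exists (2 + q)%N, (catf (pairf x z) y), N; split; rewrite ?mE //.
  + apply: (splits_catf _ _ T'0 _ sp).
    * move=> v; split => [/TE[c [d [t [hc hd Tt ->]]]]|[c [t [hc Tt ->]]]].
        exists (fun i => if i == 0 then c else d), t; split => //.
          by move=> i; case: (i == 0).
        by rewrite lin_pairf.
      by apply/TE; exists (c 0), (c 1), t; split => //; rewrite lin_pairf.
    * move=> i t Tt; have [o1 o2] := orth _ Tt.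
      exact: (pairf_all (P := fun v => B v t = 0)).
    * apply: (scale_lt_det hF (s := ov (B x z))); rewrite ?detP ?mulf_neq0 //.
      - have vxx : vge (ov (B x z)) (B x x).
          by rewrite -/(Q x) Qx; apply: vgeW (@vge_ent _ _ _ m.+1) _; lra.
        have vzz : vge (ov (B x z)) (B z z) by apply: vgeW vQz _; lra.
        have vxz : vge (ov (B x z)) (B x z) by exact: vge_ov.
        have vzx : vge (ov (B x z)) (B z x) by rewrite bform_sym.
        move=> i j; rewrite mxE.
        by apply: (pairf_all (P := fun v => vge _ (B v _)));
           apply: (pairf_all (P := fun v => vge _ (B _ v))).
      - by rewrite (ovM hF) // vb -!/(R _ _ _); lra.
      - by rewrite vb; lra.
  + rewrite gramf_catf // det_ublock detP dt.
    rewrite [RHS]big_nat_recl; last by nlia.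
    rewrite addSn [in RHS]big_nat_recl; last by nlia.
    by rewrite mulrA 2!big_add1.
  + have [->|q0] := posnP q; first by move=> _; rewrite addn0; lra.
    by move=> _; exact: ls.
  + case: (ltnP 1 q) => q1 _; first exact: lss.
    have [q0|q0] := posnP q; first by rewrite q0 addn0 /=; lra.
    have q1' : q = 1%N by nlia.
    by move: (ls q0); rewrite q1' addn1 /=; lra.
  + move=> al hal al0 jump hr hn; rewrite gramf_catf //.
    apply: (stable_det_block hF hal) => //; last exact: st.
    apply: (admissible_binary hF a_neq0 hal al0 jump hr hn bin pos) => //; first by nlia.
    * by rewrite vb; lra.
    * have [hm _ _ _] := hal; apply: good_sum_mono => //; nlia.
Qed.

End BongBlocks.

(** * Jordan decompositions *)

Section Jordan.
Context {F : fieldType} (ord : F -> int) (hF : dyadic_local_field ord).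
Context {V : vectType F} (B : {symmetric V}).

Local Notation ov := (ov ord).
Local Notation vge := (vge ord).

Lemma Ospan_Osub (W : lmodType F) (S : set W) : Osubmodule ord (Ospan ord S).
Proof.
split.
- by move=> M [[M0 _ _] _].
- by move=> x y hx hy M hM; case: (hM) => -[_ MD _] _; apply: MD; [exact: hx | exact: hy].
- by move=> c x hc hx M hM; case: (hM) => -[_ _ MZ] _; apply: MZ => //; exact: hx.
Qed.

Lemma Ospan_min (W : lmodType F) (S M : set W) : Osubmodule ord M -> S `<=` M ->
  Ospan ord S `<=` M.
Proof. exact: smallest_sub. Qed.

Lemma Osub_vge q : Osubmodule ord ([set x | vge q x] : set F^o).
Proof.
split => /=; first exact: vge0.
  by move=> x y; exact: (vgeD hF).
by move=> c x /O_vge hc hx; apply: vgeW (vgeM hF hc hx) _; rewrite add0r.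
Qed.

Lemma Osub_vgt q : Osubmodule ord ([set x | vgt ord q x] : set F^o).
Proof.
split => /=; first by rewrite /vgt eqxx.
  by move=> x y; exact: (vgtD hF).
by move=> c x /O_vge hc hx; rewrite -[q]add0r; exact: (vgtM hF).
Qed.

Lemma Osub_lin (M : set V) p (c : 'I_p -> F) (z : 'I_p -> V) : Osubmodule ord M ->
  (forall i, vge 0 (c i)) -> (forall i, M (z i)) -> M (lin c z).
Proof.
move=> hM hc hz; case: (hM) => M0 MD MZ; rewrite /lin.
elim/big_ind: _ => // i _; exact: Osub_scale hM (hc i) (hz i).
Qed.

Lemma Ospan_obasis (b : seq V) :
  obasis ord (Ospan ord [set` b]) (fun i : 'I_(size b) => b`_i).
Proof.
set z := fun i : 'I_(size b) => b`_i.
have sub : Osubmodule ord [set x | exists2 c, forall i, vge 0 (c i) & x = lin c z].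
  split => /=.
  - exists (fun=> 0); first by move=> _; exact: vge0.
    by rewrite /lin big1 // => i _; rewrite scale0r.
  - move=> x y [c hc ->] [c' hc' ->]; exists (fun i => c i + c' i).
      by move=> i; exact: (vgeD hF).
    by rewrite /lin -big_split; apply: eq_bigr => i _; rewrite scalerDl.
  - move=> k x /O_vge hk [c hc ->]; exists (fun i => k * c i).
      by move=> i; apply: vgeW (vgeM hF hk (hc i)) _; rewrite add0r.
    by rewrite /lin scaler_sumr; apply: eq_bigr => i _; rewrite scalerA.
move=> x; split => [|[c hc ->]].
  apply: (Ospan_min sub) => y /= yb; have ib : (index y b < size b)%N by rewrite index_mem.
  exists (fun j => (j == Ordinal ib)%:R).
    by move=> j; case: (j == _); [exact: (vge1 hF) | exact: vge0].
  rewrite /lin (bigD1 (Ordinal ib)) //= eqxx scale1r big1 ?addr0 /z /= ?nth_index //.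
  by move=> j /negPf->; rewrite scale0r.
apply: (Osub_lin (Ospan_Osub _) hc) => i.
by apply: sub_gen_smallest => /=; exact: mem_nth.
Qed.

(** The volume is generated by the determinants of all bases. If each had order greater than rank *
    ord c, so would every nonzero element of the volume, among them the power of c' that generates
    it; hence some basis attains this order. *)
Lemma modular_basis (M : set V) (c : F) : modular ord B M -> c != 0 ->
  scale ord B M = principal ord c ->
  exists p (z : 'I_p -> V), [/\ obasis ord M z, mxvge ord (ov c) (gramf B z),
    \det (gramf B z) != 0 & ov (\det (gramf B z)) = p%:R * ov c].
Proof.
move=> [_ _ [c' [c'0 scE vE]]] c0 scE'.
have vc : ov c' = ov c.
  have h1 : principal ord c c' by rewrite -scE' scE; exact: principal_id.
  have h2 : principal ord c' c by rewrite -scE scE'; exact: principal_id.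
  move/(principalP hF _ c0): h1 => /(_ c'0) h1.
  move/(principalP hF _ c'0): h2 => /(_ c0) h2.
  by apply/eqP; rewrite eq_le h1 h2.
have vcX n : ov (c' ^+ n) = n%:R * ov c.
  elim: n => [|n IH]; first by rewrite expr0 (ov1 hF) mul0r.
  by rewrite exprS (ovM hF) ?expf_neq0 // IH vc -natr1; lra.
have [b bM nb] : exists2 b : seq V, M = Ospan ord [set` b] &
    ~ vgt ord ((rank M)%:R * ov c) (\det (gram B b)).
  apply: contrapT => h.
  have : volume ord B M (c' ^+ rank M) by rewrite vE; exact: principal_id.
  move=> /(Ospan_min (Osub_vgt ((rank M)%:R * ov c))) /= H.
  have := H _ (expf_neq0 _ c'0); rewrite vcX ltxx => H'; suff: false by [].
  by apply: H' => x [b [_ bM] <-]; apply: contrapT => nv; apply: h; exists b.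
pose z (i : 'I_(size b)) := b`_i.
have oz : obasis ord M z by rewrite bM; exact: Ospan_obasis.
have G0 : \det (gramf B z) != 0.
  (* [vgt] holds of 0, so the failure of the strict bound also makes the determinant nonzero. *)
  by apply/eqP => G0; apply: nb; rewrite /gram -/(gramf B z) G0 /vgt eqxx.
have [rk _] := det_space_obasis hF oz G0.
have vG : mxvge ord (ov c) (gramf B z).
  move=> i j; apply/(principalP hF) => //; rewrite -scE' mxE; apply: sub_gen_smallest.
  by exists (z i), (z j); split => //; exact: (obasis_mem hF _ oz).
exists (size b), z; split => //.
apply/eqP; rewrite eq_le; apply/andP; split; last exact: (det_vge hF vG).
by rewrite leNgt; apply/negP => lt; apply: nb => _; rewrite rk.
Qed.

Context (L : set V) (t : nat) (Ls : nat -> set V) (c : nat -> F).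
Context (jordan : jordan_decomposition ord B L t Ls).
Context (scaleE : forall j, (1 <= j <= t)%N ->
  c j != 0 /\ scale ord B (Ls j) = principal ord (c j)).

Local Notation partial := (partial_sum Ls).

Lemma component_Osub j : (1 <= j <= t)%N -> Osubmodule ord (Ls j).
Proof.
case: jordan => md _ _ _ /md[[[s ->] _] _ _]; exact: Ospan_Osub.
Qed.

Lemma component_scale j x y : (1 <= j <= t)%N -> Ls j x -> Ls j y ->
  vge (ov (c j)) (B x y).
Proof.
move=> hj hx hy; have [cj0 scj] := scaleE hj; apply/(principalP hF) => //.
by rewrite -scj; apply: sub_gen_smallest; exists x, y.
Qed.

Definition tail_sum (k : nat) : set V :=
  [set v | exists x : nat -> V, (forall j, (k < j <= t)%N -> Ls j (x j)) /\
                                v = \sum_(k.+1 <= j < t.+1) x j].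

Lemma partial_sumS k v : partial k.+1 v <->
  exists u w, [/\ partial k u, Ls k.+1 w & v = u + w].
Proof.
split => [[x [hx ->]]|[_ [w [[x [hx ->]] hw ->]]]].
  exists (\sum_(1 <= j < k.+1) x j), (x k.+1); split.
  - by exists x; split => // j hj; apply: hx; nlia.
  - by apply: hx; nlia.
  - by rewrite big_nat_recr.
exists (fun j => if j == k.+1 then w else x j); split.
  by move=> j hj; case: eqVneq => [->//|ne]; apply: hx; nlia.
rewrite [RHS]big_nat_recr //= eqxx; congr (_ + _); apply: eq_big_nat => j hj.
by case: eqVneq => // jk; exfalso; nlia.
Qed.

Lemma jordan_dec k v : (k <= t)%N -> L v <->
  exists u w, [/\ partial k u, tail_sum k w & v = u + w].
Proof.
move=> kt; case: jordan => _ _ _ ->; split => [[x [hx ->]]|[_ [_ [[x [hx ->]] [y [hy ->]] ->]]]].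
  exists (\sum_(1 <= j < k.+1) x j), (\sum_(k.+1 <= j < t.+1) x j); split.
  - by exists x; split => // j hj; apply: hx; nlia.
  - by exists x; split => // j hj; apply: hx; nlia.
  - by rewrite -big_cat_nat.
exists (fun j => if (j <= k)%N then x j else y j); split.
  by move=> j hj; case: leqP => h; [apply: hx | apply: hy]; nlia.
rewrite [RHS](big_cat_nat _ (n := k.+1)) //=; congr (_ + _); apply: eq_big_nat => j hj.
  by case: leqP => // h; exfalso; nlia.
by case: leqP => // h; exfalso; nlia.
Qed.

Lemma partial_orth k l u w : (k < l)%N -> (l <= t)%N -> partial k u -> Ls l w -> B u w = 0.
Proof.
case: jordan => _ _ orth _ kl lt [x [hx ->]] hw.
rewrite bform_suml big_nat big1 // => j hj.
by apply: (orth j l) => //; [nlia | nlia | nlia | apply: hx; nlia].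
Qed.

Lemma obasis_cat (M M1 M2 : set V) p q (z : 'I_p -> V) (y : 'I_q -> V) :
  (forall v, M v <-> exists u w, [/\ M1 u, M2 w & v = u + w]) ->
  obasis ord M1 z -> obasis ord M2 y -> obasis ord M (catf z y).
Proof.
move=> ME oz oy v; split => [/ME[u [w [/oz[k hk ->] /oy[k' hk' ->] ->]]]|[k hk ->]].
  by have [k2 -> h] := lin_catE ord k k' z y; exists k2 => //; exact: h.
rewrite lin_catf; apply/ME.
exists (lin (k \o lshift q) z), (lin (k \o @rshift p q) y); split => //.
  by apply/oz; exists (k \o lshift q) => // i; exact: hk.
by apply/oy; exists (k \o @rshift p q) => // i; exact: hk.
Qed.

Lemma jordan_basis k r : (k <= t)%N -> (forall j, (1 <= j <= k)%N -> ov (c j) < r) ->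
  exists p (z : 'I_p -> V), obasis ord (partial k) z /\ scale_lt ord B z r.
Proof.
elim: k => [|k IH] kt hr.
  exists 0%N, (fun=> 0); split; last exact: scale_lt_nil.
  move=> x; split => [[y [_ ->]]|[k _ ->]].
    by exists (fun=> 0) => [[]//|]; rewrite /lin big_ord0 big_geq.
  by exists (fun=> 0); split => [j|]; [nlia | rewrite /lin big_ord0 big_geq].
have [p [z [oz sz]]] := IH (ltnW kt) (fun j hj => hr j ltac:(nlia)).
have hk : (1 <= k.+1 <= t)%N by nlia.
have [ck0 sck] := scaleE hk.
have mk : modular ord B (Ls k.+1) by case: jordan => md _ _ _; exact: md.
have [q [y [oy vG G0 vd]]] := modular_basis mk ck0 sck.
exists (p + q)%N, (catf z y); split.
  by apply: obasis_cat oz oy => v; exact: partial_sumS.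
apply: scale_lt_catf => //.
  by move=> i j; apply: (@partial_orth k k.+1) => //; [exact: (obasis_mem hF _ oz) | exact: (obasis_mem hF _ oy)].
by apply: (scale_lt_det hF vG G0 vd); apply: hr; nlia.
Qed.

Lemma tail_sum0 k : tail_sum k 0.
Proof.
exists (fun=> 0); split; last by rewrite big1_eq.
by move=> j hj; case: (component_Osub (j := j) ltac:(nlia)).
Qed.

Lemma partial_sum0 k : (k <= t)%N -> partial k 0.
Proof.
move=> kt; exists (fun=> 0); split; last by rewrite big1_eq.
by move=> j hj; case: (component_Osub (j := j) ltac:(nlia)).
Qed.

Lemma jordan_splits k r : (k <= t)%N -> (forall j, (1 <= j <= k)%N -> ov (c j) < r) ->
  (forall j, (k < j <= t)%N -> r <= ov (c j)) ->
  exists p (z : 'I_p -> V), [/\ splits ord B L z (tail_sum k) r,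
    rank (partial k) = p & exists2 k0, k0 != 0 &
      det_space B (partial k) = \det (gramf B z) * k0 ^+ 2].
Proof.
move=> kt h1 h2; have [p [z [oz sz]]] := jordan_basis kt h1.
have LE := jordan_dec _ kt.
have sp : splits ord B L z (tail_sum k) r.
  split => //.
  - move=> i; apply/LE; exists (z i), 0; split; [exact: (obasis_mem hF _ oz) | exact: tail_sum0 |].
    by rewrite addr0.
  - move=> n hn; apply/LE; exists 0, n; split => //; first exact: partial_sum0.
    by rewrite add0r.
  - by move=> x /LE[u [w [/oz[k' hk' ->] hw ->]]]; exists k', w.
  - move=> i n [x [hx ->]]; rewrite bform_sumr big_nat big1 // => j hj.
    apply: (@partial_orth k j); [nlia | nlia | exact: (obasis_mem hF _ oz) | apply: hx; nlia].
  - move=> _ _ [x [hx ->]] [y [hy ->]]; rewrite bform_suml big_nat.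
    apply: (vge_sum hF) => i hi; rewrite bform_sumr big_nat; apply: (vge_sum hF) => j hj.
    have [<-|ij] := eqVneq i j.
      have hi' : (k < i <= t)%N by nlia.
      apply: vgeW (component_scale (j := i) _ (hx _ hi') (hy _ hi')) (h2 _ hi'); nlia.
    case: jordan => _ _ orth _; rewrite (orth i j); first exact: vge0.
    + by nlia.
    + by nlia.
    + exact/eqP.
    + by apply: hx; nlia.
    + by apply: hy; nlia.
exists p, z; split => //; have G0 := splits_gram_neq0 sp.
  by have [-> _] := det_space_obasis hF oz G0.
by have [_] := det_space_obasis hF oz G0.
Qed.

End Jordan.

(** C is unimodular: C M C^T + E = C (M + C^-1 E C^-T) C^T, the transformed E is a perturbation of
    the same kind, and det C contributes a square. *)
Lemma stable_det_congr (F : fieldType) (ord : F -> int) (a : seq F) (m : nat) (al r : rat)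
    n (M E C : 'M[F]_n) : dyadic_local_field ord -> alpha_level ord a m al ->
  0 < al -> R ord a m < R ord a m.+1 ->
  (R ord a m + R ord a m.+1) / 2 <= r -> R ord a m.+1 <= e ord + r ->
  stable_det ord a m al r M -> pert ord a m al r E ->
  mxvge ord 0 C -> \det C != 0 -> ov ord (\det C) = 0 ->
  dge ord (\det M * \det (C *m M *m C^T + E)) al.
Proof.
move=> hF hal al0 jump hr hn [M0 hM] hE vC C0 vdC.
have uC : C \in unitmx by rewrite unitmxE unitfE.
have vI : mxvge ord 0 (invmx C)^T.
  apply: mxvge_tr; rewrite -oppr0; apply: (invmx_vge hF) => //; rewrite ?mulr0 //.
have [S0 dS] := hM _ (pert_congr hF hal al0 jump hr hn hE vI).
set S := _ + _ in S0 dS.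
have -> : C *m M *m C^T + E = C *m S *m C^T.
  rewrite /S trmxK mulmxDr mulmxDl; congr (_ + _).
  rewrite !mulmxA mulmxV // mul1mx -mulmxA -trmx_mul mulmxV // trmx1 mulmx1 //.
rewrite !det_mulmx det_tr.
have -> : \det M * (\det C * \det S * \det C) = (\det M * \det S) * \det C ^+ 2 by ring.
by apply: (dgeM hF); rewrite ?sqrf_eq0 ?mulf_neq0 //; exact: dge_sq.
Qed.

(** * Approximations *)

(* If i lies in the k-th Jordan range m < i < m2, then alpha_i <= alpha_m, and
   R_l + R_(l+1) = 2r for m < l < m2 forces d(-a_j a_(j+1)) >= alpha_i for the
   consecutive pairs pairing off a_(m+1), ..., a_i. *)

Section Approximation.
Context {F : fieldType} (ord : F -> int) (hF : dyadic_local_field ord).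
Context {V : vectType F} (B : {symmetric V}).

Local Notation Q := (Q B).

Lemma bong_anisotropic xs (T : set V) j : is_bong ord B xs T ->
  (1 <= j <= size xs)%N -> ent [seq Q x | x <- xs] j != 0.
Proof.
case: j => [|j]; first by rewrite ltn0.
rewrite /ent /=; elim: xs T j => [|x xs IH] T j /=; first by rewrite ltn0.
by case=> _ x0 _ hb; case: j => [|j] // hj; apply: IH hb _.
Qed.

(** Every term of alpha_m dominates a term of alpha_i. For m <= l < i, the pair (l, l+1) lies to the
    right of m but to the left of i, and R_(i+1) - R_l <= R_(l+1) - R_m is the hypothesis on
    sums. *)
Lemma alpha_level_transfer (a : seq F) i m al : (1 <= m <= i)%N ->
  R ord a i.+1 <= R ord a m.+1 -> R ord a i.+1 - R ord a i <= R ord a m.+1 - R ord a m ->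
  R ord a m <= R ord a i ->
  (forall l, (m <= l < i)%N -> R ord a i.+1 + R ord a m <= R ord a l + R ord a l.+1) ->
  alpha_level ord a i al -> alpha_level ord a m al.
Proof.
move=> hm h1 h2 h3 h4 [hi g0 g1 g2]; split.
- by nlia.
- lra.
- by move=> l hl; apply: dgeW (g1 l ltac:(nlia)) _; lra.
- move=> l hl; have [li|il] := ltnP l i.
    by apply: dgeW (g1 l ltac:(nlia)) _; have := h4 l ltac:(nlia); lra.
  by apply: dgeW (g2 l ltac:(nlia)) _; lra.
Qed.

Lemma prod_pairs (f : nat -> F) m n d : (m <= n)%N ->
  \prod_(m <= j < n + d.*2) f j =
  (\prod_(m <= j < n) f j) * \prod_(0 <= s < d) (f (n + s.*2)%N * f (n + s.*2).+1).
Proof.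
move=> mn; elim: d => [|d IH]; first by rewrite addn0 [X in _ * X]big_geq // mulr1.
rewrite doubleS !addnS !big_nat_recr //= ?IH ?mulrA //; nlia.
Qed.

Lemma prod_sign (u v : nat -> F) d :
  \prod_(0 <= s < d) (- u s * v s) = (-1) ^+ d * \prod_(0 <= s < d) (u s * v s).
Proof.
elim: d => [|d IH]; first by rewrite !big_geq // mulr1.
by rewrite !big_nat_recr //= IH exprS; ring.
Qed.

Context (a : seq F) (a_neq0 : forall j, (1 <= j <= size a)%N -> ent a j != 0).
Context (good_a : good ord a).

Local Notation ov := (ov ord).
Local Notation vge := (vge ord).
Local Notation dge := (dge ord).
Local Notation RR := (R ord a).
Local Notation ee := (e ord).

(** The perturbation is the Gram matrix of the components of z in T; they pair with T into p^r,
    which puts their values in G. *)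
Lemma bong_det_approx (L N T : set V) m (z y : 'I_m -> V) r al :
  splits ord B L z N r -> threshold ord B a 0 L r y T ->
  alpha_level ord a m al -> 0 < al -> RR m < RR m.+1 ->
  (RR m + RR m.+1) / 2 <= r -> RR m.+1 <= ee + r ->
  dge (\det (gramf B y) * \det (gramf B z)) al.
Proof.
move=> sz [sy tl _ _ _ _ _ _ st] hal al0 jump hr hn.
have [C [u [vC C0 vdC hu ->]]] := splits_gram hF sz sy.
apply: (stable_det_congr hF hal al0 jump hr hn (st _ hal al0 jump hr hn) _ vC C0 vdC).
split.
- by apply/matrixP => i j; rewrite !mxE bform_sym.
- by move=> i j; rewrite mxE; apply: (splits_scale sy).
- move=> i; rewrite mxE.
  have [] := norm_gp_bong hF a_neq0 tl hal hr (hu i) (fun w hw => splits_scale sy (hu i) hw).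
  by split.
Qed.

Lemma run_values r m m2 d : (forall l, (m < l < m2)%N -> RR l + RR l.+1 = 2 * r) ->
  (m < m2)%N ->
  ((m.+1 + d.*2 <= m2)%N -> RR (m.+1 + d.*2) = RR m.+1) /\
  ((m.+2 + d.*2 <= m2)%N -> RR (m.+2 + d.*2) = 2 * r - RR m.+1).
Proof.
move=> run lt; elim: d => [|d [IH1 IH2]].
  by rewrite !addn0; split => // h; have := run m.+1 ltac:(nlia); lra.
rewrite doubleS !addnS; split => h.
  have := run (m.+2 + d.*2)%N ltac:(nlia); rewrite IH2; last by nlia.
  by rewrite !addSn in h *; lra.
have h1 := run (m.+2 + d.*2)%N ltac:(nlia).
have h2 := run (m.+3 + d.*2)%N ltac:(nlia).
have := IH2 ltac:(nlia); rewrite !addSn in h h1 h2 *; lra.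
Qed.

Lemma prefix_prod_neq0 i : (i <= size a)%N -> prefix_prod a i != 0.
Proof.
move=> hi; rewrite /prefix_prod prodf_seq_neq0; apply/allP => j.
by rewrite mem_index_iota => hj; apply/implyP => _; apply: a_neq0; nlia.
Qed.

Section Run.
Context (m m2 : nat) (r : rat) (D : F).
Context (m_lt : (m < m2)%N) (m2_le : (m2 <= size a)%N) (D_neq0 : D != 0).
Context (run : forall l, (m < l < m2)%N -> RR l + RR l.+1 = 2 * r).
Context (r_le : r <= RR m.+1) (R_le : (1 <= m)%N -> RR m < r).
Context (approx_m : forall al, 0 < al -> ((1 <= m)%N -> alpha_level ord a m al) ->
  dge (prefix_prod a m * D) al).

Lemma prefix_prod_pairs d : prefix_prod a (m + d.*2) =
  prefix_prod a m * \prod_(0 <= s < d) (ent a (m.+1 + s.*2) * ent a (m.+1 + s.*2).+1).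
Proof. by rewrite /prefix_prod -addSn prod_pairs. Qed.

(** R_(i+1) equals R_j for the first index j of each pair, so the terms R_(i+1) - R_j + d(-a_j
    a_(j+1)) of alpha_i are the bare defects; the signs of the pairs produce the power of -1. *)
Lemma approx_even d al : (1 <= m + d.*2)%N -> (m + d.*2 < m2)%N ->
  alpha_level ord a (m + d.*2) al ->
  dge (prefix_prod a (m + d.*2) * ((-1) ^+ d * D)) al.
Proof.
set i := (m + d.*2)%N => i1 im hal; have [le0|al0] := lerP al 0; first exact: dge_le0.
case: (hal) => hi g0 g1 g2.
have Ri1 : RR i.+1 = RR m.+1.
  by have [h _] := run_values d run m_lt; rewrite /i -addSn h.
have Ri : (1 <= m)%N -> RR m <= RR i by move=> m1; apply: good_mono => //; rewrite -/i; nlia.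
have dm : dge (prefix_prod a m * D) al.
  apply: approx_m => // m1; apply: alpha_level_transfer hal; [nlia|lra| | exact: Ri |].
    by have := Ri m1; lra.
  move=> l hl; rewrite Ri1 addrC; apply: (good_sum_mono good_a); nlia.
rewrite prefix_prod_pairs.
set P := \prod_(0 <= s < d) _.
have -> : prefix_prod a m * P * ((-1) ^+ d * D) = prefix_prod a m * D * ((-1) ^+ d * P) by ring.
rewrite -prod_sign.
have h s : s \in index_iota 0 d -> true ->
   - ent a (m.+1 + s.*2) * ent a (m.+1 + s.*2).+1 != 0 /\
   dge (- ent a (m.+1 + s.*2) * ent a (m.+1 + s.*2).+1) al.
  rewrite mem_index_iota => hs _; have sd : (s.*2.+2 <= d.*2)%N by nlia.
  split.
    by rewrite mulf_neq0 ?oppr_eq0 //; apply: a_neq0; rewrite /i in im; nlia.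
  apply: dgeW (g1 (m.+1 + s.*2)%N _) _; first by rewrite /i; nlia.
  have [hs1 _] := run_values s run m_lt.
  by rewrite hs1 ?Ri1; [lra | rewrite /i in im; nlia].
have [p0 dp] := dge_prod hF h.
apply: (dgeM hF) => //; rewrite mulf_neq0 // prefix_prod_neq0 //; nlia.
Qed.

Lemma approx_odd d al x : (m.+1 + d.*2 < m2)%N -> alpha_level ord a (m.+1 + d.*2) al ->
  norm_gp ord a (m.+1 + d.*2) al x -> x != 0 -> ov x <= RR m.+1 ->
  dge (prefix_prod a (m.+1 + d.*2) * (x * D)) al.
Proof.
set i := (m.+1 + d.*2)%N => im hal Gx x0 vx; have rle := r_le.
have [le0|al0] := lerP al 0; first exact: dge_le0.
case: (hal) => hi g0 g1 g2.
have Ri : RR i = RR m.+1 by have [-> //] := run_values d run m_lt; rewrite /i in im; nlia.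
have Ri1 : RR i.+1 = 2 * r - RR m.+1.
  by have [_ h] := run_values d run m_lt; rewrite /i -addSn h // addSn; rewrite /i in im; nlia.
have ale : al <= ee by lra.
have Rm : (1 <= m)%N -> RR m <= RR m.+1 by move=> /R_le; lra.
have dm : dge (prefix_prod a m * D) al.
  apply: approx_m => // m1; have := Rm m1 => Rm1.
  apply: alpha_level_transfer hal; [by rewrite /i; nlia|lra|lra|lra|].
  move=> l hl; have := good_sum_mono good_a (l := m) (k := l) ltac:(nlia) ltac:(nlia); lra.
have -> : prefix_prod a i = prefix_prod a (m + d.*2) * ent a i.
  by rewrite /prefix_prod /i addSn big_nat_recr.
rewrite prefix_prod_pairs; set P := \prod_(0 <= s < d) _.
have -> : prefix_prod a m * P * ent a i * (x * D) =
  prefix_prod a m * D * P * (ent a i * x) by ring.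
have ai : ent a i != 0 by apply: a_neq0; nlia.
have dx : dge (ent a i * x) al.
  (* The product is (a_i X)^2 + a_i w; the upper bound on [ov x] makes a_i w small relative to a_i
     x. *)
  case: Gx => X [w [xE _ _ vw]]; exists (ent a i * X), (ent a i * w); split.
    by rewrite xE; ring.
  by apply: vgeW (vgeM hF (@vge_ent _ _ _ i) vw) _; rewrite (ovM hF) // -/(R ord a i); lra.
have h s : s \in index_iota 0 d -> true ->
   ent a (m.+1 + s.*2) * ent a (m.+1 + s.*2).+1 != 0 /\
   dge (ent a (m.+1 + s.*2) * ent a (m.+1 + s.*2).+1) al.
  rewrite mem_index_iota => hs _; have sd : (s.*2.+2 <= d.*2)%N by nlia.
  have a1 : ent a (m.+1 + s.*2) != 0 by apply: a_neq0; rewrite /i in im; nlia.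
  have a2 : ent a (m.+1 + s.*2).+1 != 0 by apply: a_neq0; rewrite /i in im; nlia.
  split; first by rewrite mulf_neq0.
  rewrite -[ent a (m.+1 + s.*2)]opprK mulNr -mulN1r.
  apply: (dgeM hF); rewrite ?oppr_eq0 ?oner_neq0 ?mulf_neq0 ?oppr_eq0 //.
    exact: dgeW (dge_N1 hF) ale.
  apply: dgeW (g1 (m.+1 + s.*2)%N _) _; first by rewrite /i; nlia.
  have [hs1 _] := run_values s run m_lt.
  by rewrite hs1 ?Ri1; [lra | rewrite /i in im; nlia].
have [p0 dp] := dge_prod hF h.
have pm0 : prefix_prod a m != 0 by apply: prefix_prod_neq0; nlia.
apply: (dgeM hF) => //; rewrite ?mulf_neq0 //.
by apply: (dgeM hF); rewrite ?mulf_neq0.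
Qed.

End Run.

End Approximation.

(** * Matching the Jordan ranges with the indices of the BONG *)

Lemma scale_strict (F : fieldType) (ord : F -> int) (V : vectType F) (B : {symmetric V})
    L t Ls (c : nat -> F) j l : dyadic_local_field ord ->
  jordan_decomposition ord B L t Ls ->
  (forall j, (1 <= j <= t)%N -> c j != 0 /\ scale ord B (Ls j) = principal ord (c j)) ->
  (1 <= j < l)%N -> (l <= t)%N -> ov ord (c j) < ov ord (c l).
Proof.
move=> hF [_ strict _ _] scaleE /andP[j1]; elim: l => // l IH jl lt.
have step : (j <= l)%N -> ov ord (c l) < ov ord (c l.+1).
  move=> jl'; have [cl0 scl] := scaleE l ltac:(nlia).
  have [cl1 scl1] := scaleE l.+1 ltac:(nlia).
  have [] := strict l ltac:(nlia); rewrite scl scl1 => sub nsub.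
  have le : ov ord (c l) <= ov ord (c l.+1).
    by have /(principalP hF _ cl0) /(_ cl1) := sub _ (principal_id hF (c l.+1)).
  rewrite lt_neqAle le andbT; apply/eqP => vE; apply: nsub => x.
  by move=> /(principalP hF _ cl0) h; apply/(principalP hF _ cl1); rewrite -vE.
move: jl; rewrite ltnS leq_eqVlt => /orP[/eqP jl|jl].
  by rewrite {1}jl; apply: step; rewrite jl.
by apply: lt_trans (IH jl (ltnW lt)) (step (ltnW jl)).
Qed.

Lemma scale_subset (F : fieldType) (ord : F -> int) (V : vectType F) (B : {symmetric V})
    (M : set V) (q : rat) : dyadic_local_field ord ->
  (forall x y, M x -> M y -> vge ord q (B x y)) ->
  forall s, scale ord B M s -> vge ord q s.
Proof.
move=> hF h; apply: (Ospan_min (Osub_vge hF q)) => s [x [y [hx hy ->]]]; exact: h.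
Qed.

Lemma det_gramf0 (F : fieldType) (V : vectType F) (B : {symmetric V}) p (z : 'I_p -> V) :
  p = 0%N -> \det (gramf B z) = 1.
Proof. by move=> p0; move: z; rewrite p0 => z; exact: det_mx00. Qed.

Lemma int_sum_le (x y z : int) : x%:~R + y%:~R < 2 * z%:~R + 1 :> rat ->
  x%:~R + y%:~R <= 2 * z%:~R :> rat.
Proof.
have -> : 2 * z%:~R + 1 = (2 * z + 1)%:~R :> rat by rewrite rmorphD rmorphM.
have -> : 2 * z%:~R = (2 * z)%:~R :> rat by rewrite rmorphM.
by rewrite -rmorphD ltr_int ler_int ltzD1.
Qed.

Theorem lemma3p2 (F : fieldType) (ord : F -> int) (V : vectType F)
    (B : {symmetric V}) (L : set V) (a : seq F) (t : nat) (Ls : nat -> set V)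
    (k i : nat) :
  dyadic_local_field ord ->
  nondegenerate B ->
  lattice ord B L ->
  has_good_bong ord B L a ->
  jordan_decomposition ord B L t Ls ->
  (1 <= k <= t)%N ->
  (rank (partial_sum Ls k.-1) <= i < rank (partial_sum Ls k))%N ->
  (i = rank (partial_sum Ls k.-1) %[mod 2] ->
   approximates ord a i
     ((-1) ^+ ((i - rank (partial_sum Ls k.-1)) %/ 2)
        * det_space B (partial_sum Ls k.-1))) /\
  (i = (rank (partial_sum Ls k.-1)).+1 %[mod 2] ->
   forall ak : F,
   group_norm_generator ord B (part_in B L (scale ord B (Ls k))) ak ->
   approximates ord a i (ak * det_space B (partial_sum Ls k.-1))).
Proof.
move=> hF _ latL [xs [hb aE ga]] jd hk hi.
have a0 j : (1 <= j <= size a)%N -> ent a j != 0.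
  by rewrite aE size_map; exact: bong_anisotropic hb.
have subL : Osubmodule ord L by case: latL => -[s ->] _; exact: Ospan_Osub.
have bs0 : bong_split ord B a 0 L.
  apply: (bong_splits hF ga (leqnn (size xs)) subL hb) => //; last by constructor 1.
  by rewrite drop0 aE.
have /choice [c hc] : forall j, exists c, (1 <= j <= t)%N ->
    c != 0 /\ scale ord B (Ls j) = principal ord c.
  move=> j; case: (boolP (1 <= j <= t)%N) => hj; last by exists 0.
  by case: jd => md _ _ _; case: (md j hj) => _ _ [c [c0 scE _]]; exists c.
pose r := ov ord (c k).
have [ck0 sck] := hc k hk.
have ltc j l : (1 <= j < l)%N -> (l <= t)%N -> ov ord (c j) < ov ord (c l).
  exact: scale_strict hF jd hc.
have [p [z [sz rkz [k0 k00 dE]]]] := jordan_splits hF jd hc (k := k.-1) (r := r)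
  ltac:(nlia) (fun j hj => ltc j k ltac:(nlia) ltac:(nlia)) ltac:(
    move=> j hj; have [->|ne] := eqVneq j k; [exact: lexx | apply: ltW; apply: ltc; nlia]).
(* All scale orders are integers, so r + 1/2 separates L_k from the later components and this cut
   yields n_k. *)
have [p2 [z2 [sz2 rkz2 _]]] := jordan_splits hF jd hc (k := k) (r := r + 2^-1)
  ltac:(nlia) ltac:(
    move=> j hj; have [->|ne] := eqVneq j k; [rewrite -/r; lra |
     have := ltc j k ltac:(nlia) ltac:(nlia); rewrite -/r; lra])
  ltac:(move=> j hj; have := ov_int_lt (ltc k j ltac:(nlia) ltac:(nlia)); rewrite -/r; lra).
have [q [y [T thr]]] := bong_threshold hF a0 ga r bs0.
have [q2 [y2 [T2 thr2]]] := bong_threshold hF a0 ga (r + 2^-1) bs0.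
have qp := splits_size hF sz (thr_splits thr).
have qp2 := splits_size hF sz2 (thr_splits thr2).
case: _ / qp y thr => y thr; case: _ / qp2 y2 thr2 => y2 thr2.
rewrite rkz rkz2 in hi *; clear rkz rkz2 sz2 z2.
have p2s : (p2 <= size a)%N := bong_split_le (thr_tail thr2).
have pp2 : (p < p2)%N by nlia.
set D := det_space B (partial_sum Ls k.-1).
have Gz0 := splits_gram_neq0 sz.
have D0 : D != 0 by rewrite /D dE mulf_neq0 ?sqrf_eq0.
have r_le : r <= R ord a p.+1 by apply: (thr_next thr); nlia.
have R_lt : (1 <= p)%N -> R ord a p < r := thr_last thr.
(* The cut at r + 1/2 gives only a sum < 2r + 1; integrality sharpens it. *)
have top_sum : (1 < p2)%N -> R ord a p2.-1 + R ord a p2 <= 2 * r.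
  by move=> h; apply: int_sum_le; have := thr_last_sum thr2 h; rewrite -/(R _ _ _) -/(R _ _ _) -/r; lra.
have top : R ord a p2 <= r.
  have := @int_sum_le (ord (ent a p2)) (ord (ent a p2)) (ord (c k)).
  have := thr_last thr2 ltac:(nlia); rewrite -/(R ord a p2) -/(ov ord (c k)) -/r add0n; lra.
(* The sums R_l + R_(l+1) are nondecreasing in l: the first one past the cut at r is >= 2r, the last
   one before the cut at r + 1/2 is <= 2r. *)
have run l : (p < l < p2)%N -> R ord a l + R ord a l.+1 = 2 * r.
  move=> hl; apply/eqP; rewrite eq_le; apply/andP; split.
    have := good_sum_mono ga (l := l) (k := p2.-1) ltac:(nlia) ltac:(nlia).
    by have := top_sum ltac:(nlia); rewrite prednK; [lra | nlia].
  have [h _] := thr_next_sum thr ltac:(rewrite add0n; nlia).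
  by have := good_sum_mono ga (l := p.+1) (k := l) ltac:(nlia) ltac:(nlia); rewrite add0n in h; lra.
have approx_m al : 0 < al -> ((1 <= p)%N -> alpha_level ord a p al) ->
    dge ord (prefix_prod a p * D) al.
  move=> al0 hal; rewrite /D dE.
  have [p0|p0] := posnP p.
    by rewrite (det_gramf0 _ _ p0) mul1r /prefix_prod p0 big_geq // mul1r; exact: dge_sq.
  have sum_p : R ord a p + R ord a p.+1 <= 2 * r.
    have := good_sum_mono ga (l := p) (k := p2.-1) ltac:(nlia) ltac:(nlia).
    by have := top_sum ltac:(nlia); rewrite prednK; [lra | nlia].
  (* If L_k has rank one, R_(p+1) <= r; otherwise R_(p+1) + R_(p+2) = 2r is combined with R_(p+1) <=
     R_(p+2) + 2e. *)
  have norm_le : R ord a p.+1 <= e ord + r.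
    have e0 := ov2_gt0 hF; have [pE|ne] := eqVneq p.+1 p2; first by rewrite pE; lra.
    have [_ h] := thr_next_sum thr ltac:(rewrite add0n; nlia).
    by have := run p.+1 ltac:(nlia); rewrite add0n in h; lra.
  have jump : R ord a p < R ord a p.+1 by have := R_lt p0; lra.
  have hr : (R ord a p + R ord a p.+1) / 2 <= r by lra.
  have dp := bong_det_approx hF a0 sz thr (hal p0) al0 jump hr norm_le.
  rewrite (thr_det thr) -/(prefix_prod a p) in dp.
  rewrite mulrA; apply: (dgeM hF) => //; rewrite ?sqrf_eq0 ?mulf_neq0 //; last exact: dge_sq.
  by apply: (prefix_prod_neq0 a0); nlia.
have approx_of X : X != 0 -> (i = 0%N -> exists2 k1, k1 != 0 & X = k1 ^+ 2) ->
    (forall al, (1 <= i)%N -> alpha_level ord a i al -> dge ord (prefix_prod a i * X) al) ->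
    approximates ord a i X.
  move=> X0 hX0 hX; split => //.
  - move=> his; apply: le_ereal_rat => al hal.
    have P0 : prefix_prod a i != 0 by apply: (prefix_prod_neq0 a0); nlia.
    apply/(dgeP hF); first by rewrite mulf_neq0.
    by apply: hX; [nlia | exact: (alpha_levelP hF a0 his hal)].
  - case=> [i0|isz]; last by exfalso; nlia.
    have [k1 k10 ->] := hX0 i0; exists k1 => //.
    by rewrite i0 /prefix_prod big_geq // mul1r.
split => [ip|ip ak [akG akN]].
  set d := (_ %/ 2)%N; have iE : i = (p + d.*2)%N.
    by rewrite /d; move: ip hi; clear; nlia.
  apply: approx_of; first by rewrite mulf_neq0 // signr_eq0.
    move=> i0; have [p0 d0] : p = 0%N /\ d = 0%N by nlia.
    by exists k0 => //; rewrite d0 expr0 mul1r /D dE (det_gramf0 _ _ p0) mul1r.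
  rewrite iE => al i1 hal.
  by apply: (approx_even hF a0 ga pp2 p2s D0 run approx_m) => //; nlia.
pose d := ((i - p) %/ 2)%N; have iE : i = (p.+1 + d.*2)%N.
  by rewrite /d; move: ip hi; clear; nlia.
have part_scale x w : part_in B L (scale ord B (Ls k)) x -> L w -> vge ord r (B x w).
  by case=> _ h Lw; apply/(principalP hF _ ck0); rewrite -sck; exact: h.
(* The first vector of the tail lies in the part of L pairing into the scale of L_k and takes the
   value a_(p+1), so the norm generator divides a_(p+1). *)
have first_le : ak != 0 /\ ov ord ak <= R ord a p.+1.
  have [x Tx Qx] := thr_first thr ltac:(rewrite add0n; nlia).
  have Px : part_in B L (scale ord B (Ls k)) x.
    split; first exact: (splits_sub (thr_splits thr)).
    move=> w /(splits_dec (thr_splits thr))[u [n [_ Tn ->]]].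
    rewrite sck; apply/(principalP hF _ ck0).
    rewrite bformDr bform_sumr big1 ?add0r; last first.
      by move=> j _; rewrite bformZr bform_sym (splits_orth (thr_splits thr)) // mulr0.
    exact: (splits_scale (thr_splits thr)).
  have : norm ord B (part_in B L (scale ord B (Ls k))) (ent a p.+1).
    by apply: sub_gen_smallest; exists x.
  have ap0 : ent a p.+1 != 0 by apply: a0; nlia.
  rewrite -akN => hap; have [ak0|ak0] := eqVneq ak 0.
    by move: hap ap0; rewrite ak0 => /(principal0 ord) ->; rewrite eqxx.
  by split => //; move: hap => /(principalP hF _ ak0) /(_ ap0).
case: first_le => ak0 vak.
apply: approx_of; first by rewrite mulf_neq0.
  by move=> i0; exfalso; nlia.
move=> al i1 hal; rewrite iE in hal *.
apply: (approx_odd hF a0 ga pp2 p2s D0 run r_le R_lt approx_m) => //; first by nlia.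
have rE : (R ord a (p.+1 + d.*2) + R ord a (p.+1 + d.*2).+1) / 2 <= r.
  by rewrite run; [lra | nlia].
case: akG => x [s [Px hs ->]].
have vs : vge ord r s.
  apply: (scale_subset hF _ hs) => u v hu [Lv _]; exact: part_scale.
apply: (norm_gpD hF hal); last exact: (norm_gp_2scale hal rE (vge_mul2 hF vs)).
have Lx : L x by case: Px.
by have [] := norm_gp_bong hF a0 bs0 hal rE Lx (fun w Lw => part_scale x w Px Lw).
Qed.
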